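(* Assume $\mathrm{ZFC}+E^+(\kappa^+)$. Let $(\mathbf{K},\preccurlyeq)$ be a weak AEC with Löwenheim–Skolem number $\mu$ which is strongly $\kappa^+$-categorical for a cardinal $\kappa\geq\mu+\aleph_0$ and satisfies $\mathrm{CP}^\delta_{\kappa,\lambda}(\mathbf{K},\preccurlyeq)$ for some regular cardinal $\lambda\leq\kappa$ and some limit ordinal $\delta<\kappa^+$. Then there is an $\mathfrak{L}_{\infty,\kappa^+}$-free structure $M$ of cardinality $\kappa^+$ with $M\not\cong F(\kappa^+)$. In particular, $\mathbf{K}$ is not axiomatisable in $\mathfrak{L}_{\infty,\kappa^+}$.
   Context: An abstract class $(\mathbf{K},\preccurlyeq)$: $\mathbf{K}$ a class of $L$-structures, $\preccurlyeq$ a partial order on $\mathbf{K}$, both closed under isomorphism, with $A\preccurlyeq B$ implying $A$ is a substructure of $B$. A strong embedding is an embedding $f:A\to B$ with $f(A)\preccurlyeq B$. A weak AEC with Löwenheim–Skolem number $\mu$: an abstract class such that for every continuous $\preccurlyeq$-chain $(A_i)_{i<\delta}$ in $\mathbf{K}$, $\bigcup_iA_i\in\mathbf{K}$ and $A_j\preccurlyeq\bigcup_iA_i$ for all $j$; and $\mu\geq|L|+\aleph_0$ with: for $A\in\mathbf{K}$, $B\subseteq A$ there is $C\in\mathbf{K}$, $B\subseteq C\preccurlyeq A$, $|C|\leq|B|+\mu$. $\mathbf{K}_\kappa$ = members of cardinality $\kappa$. Coherentisation: for $A,B\in\mathbf{K}$ with $A$ a substructure of $B$, $A\preccurlyeq^{\mathrm{c}}B$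 iff there are $C\in\mathbf{K}$ with $|C|=|A|+|B|+\mu$ and an embedding $f:B\to C$ with $A\preccurlyeq C$ and $f(B)\preccurlyeq C$. $B$ is universal over $A$ ($A,B\in\mathbf{K}$) if every $C\in\mathbf{K}$ with $A\preccurlyeq C$, $|C|=|A|$, strongly embeds into $B$ over $A$. For limit $\delta<\kappa^+$, $B$ is a $(\kappa,\delta)$-$(\mathbf{K},\preccurlyeq)$-limit over $A$ if there is a continuous $\preccurlyeq$-chain $(B_i)_{i<\delta}$ in $\mathbf{K}_\kappa$ with $B_0=A$, $B=\bigcup_iB_i$, each $B_{i+1}$ universal over $B_i$. Strongly $\kappa^+$-categorical: (1) exactly one model of size $\kappa^+$ up to isomorphism, denoted $F(\kappa^+)$; (2) every $A\in\mathbf{K}_\kappa$ has some $B\in\mathbf{K}_\kappa$, $B\neq A$, $A\preccurlyeq B$; (3) every $A\in\mathbf{K}_\kappa$ has some $B\in\mathbf{K}_\kappa$ universal over $A$. $\mathrm{CP}^\delta_{\kappa,\lambda}(\mathbf{K},\preccurlyeq)$: there are a continuous $\preccurlyeq$-chain $(A_i)_{i<\lambda}$ in $\mathbf{K}_\kappa$ and $B\in\mathbf{K}_\kappa$ such that $A_{i+1}$ is a $(\kappa,\delta)$-limit over $A_i$ and $B$ is a $(\kappa,\delta)$-limit over $A_i$ for all $i<\lambda$, and $\bigcup_{i<\lambda}A_i\not\preccurlyeq^{\mathrm{c}}B$. $M$ is $\mathfrak{L}_{\infty,\kappa^+}$-free if $M\equiv_{\infty,\kappa^+}F(\kappa^+)$.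 For a regular uncountable cardinal $\theta$, $E^+(\theta)$ is the statement: for every regular cardinal $\lambda<\theta$ there is a stationary $S_\lambda\subseteq\theta$ consisting of ordinals of cofinality $\lambda$ such that $S_\lambda\cap\alpha$ is not stationary in $\alpha$ for every limit $\alpha<\theta$ (of uncountable cofinality). *)

(* Defs.v *)
From mathcomp Require Import all_boot.
From mathcomp Require Import boolp classical_sets functions cardinality wochoice.

Set Implicit Arguments.
Unset Strict Implicit.
Unset Printing Implicit Defensive.

Local Open Scope classical_set_scope.
Local Open Scope card_scope.

(* A cardinal is given by any type of that cardinality: sums of cardinals are
   disjoint unions of types and aleph_0 is [nat].  Ordinals are well-ordered
   types. *)

Definition card_lt (T U : Type) : Prop :=
  [set: T] #<= [set: U] /\ ~ ([set: U] #<= [set: T]).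

Record wellorder : Type := Wellorder {
  wo_sort :> Type;
  wo_le : rel wo_sort;
  wo_leP : well_order wo_le }.

Definition wo_lt (W : wellorder) (x y : W) : Prop := wo_le x y /\ x <> y.

Lemma wo_refl (W : wellorder) (x : W) : wo_le x x.
Proof.
have [|m [[/asboolP -> lbm] _]] := @wo_leP W (fun y => `[< y = x >]).
  by exists x; apply/asboolP.
by apply: lbm; apply/asboolP.
Qed.

Lemma wo_anti (W : wellorder) (x y : W) : wo_le x y -> wo_le y x -> x = y.
Proof.
move=> xy yx; pose B : {pred W} := fun u => `[< u = x \/ u = y >].
have [|m [_ um]] := @wo_leP W B.
  by exists x; apply/asboolP; left.
have minB u : u = x \/ u = y -> minimum_of (@wo_le W) B u.
  move=> uE; split; first exact/asboolP.
  by move=> v /asboolP vE; case: uE => ->; case: vE => -> //; exact: wo_refl.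
have mx : m = x by apply: um; apply: minB; left.
have my : m = y by apply: um; apply: minB; right.
by rewrite -mx.
Qed.

Section Segment.
Variables (W : wellorder) (a : W).

Definition seg_sort : Type := [set x : W | wo_lt x a].

Definition seg_le : rel seg_sort := fun x y => wo_le (val x) (val y).

Lemma seg_leP : well_order seg_le.
Proof.
move=> A [x Ax].
pose B : {pred W} := fun y => `[< exists2 z : seg_sort, z \in A & val z = y >].
have [|m [[/asboolP[z Az zm] lbm] _]] := @wo_leP W B.
  by exists (val x); apply/asboolP; exists x.
have lbz : lower_bound seg_le A z.
  move=> y Ay; rewrite /seg_le zm.
  by apply: lbm; apply/asboolP; exists y.
exists z; split=> // z' [Az' lbz']; apply: val_inj; apply: wo_anti.
  exact: lbz.
exact: lbz'.
Qed.

(* The ordinal [a], as the set of smaller ordinals. *)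
Definition seg : wellorder := Wellorder seg_leP.

End Segment.

Section Ordinals.
Implicit Types W D : wellorder.

Definition is_limit_ordinal W : Prop :=
  inhabited W /\ forall x : W, exists y : W, wo_lt x y.

Definition is_zero W (x : W) : Prop := forall y : W, ~ wo_lt y x.

Definition is_succ W (x y : W) : Prop :=
  wo_lt x y /\ forall z : W, ~ (wo_lt x z /\ wo_lt z y).

Definition ord_iso D W : Prop :=
  exists2 f : D -> W, bijective f & forall x y, wo_le x y = wo_le (f x) (f y).

Definition ord_lt D W : Prop := exists a : W, ord_iso D (seg a).

Definition cofinal W (C : set W) : Prop :=
  forall x : W, exists2 c, C c & wo_le x c.

(* The cofinality of [W] is the cardinality of [lam]. *)
Definition has_cofinality W (lam : Type) : Prop :=
  (exists2 C : set W, cofinal C & C #= [set: lam]) /\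
  (forall C : set W, cofinal C -> [set: lam] #<= C).

Definition uncountable_cofinality W : Prop :=
  forall C : set W, cofinal C -> ~ countable C.

Definition is_initial_ordinal W : Prop := forall a : W, card_lt (seg a) W.

Definition is_regular_cardinal W : Prop :=
  [/\ is_initial_ordinal W, [set: nat] #<= [set: W] & has_cofinality W W].

Definition is_succ_cardinal (kappa : Type) W : Prop :=
  [/\ is_initial_ordinal W, card_lt kappa W
    & forall T : Type, card_lt kappa T -> [set: W] #<= [set: T]].

Definition club W (C : set W) : Prop :=
  cofinal C /\
  forall a : W, is_limit_ordinal (seg a) ->
    cofinal [set x : seg a | C (val x)] -> C a.

Definition stationary W (S : set W) : Prop :=
  forall C : set W, club C -> S `&` C !=set0.

Definition E_plus (theta : wellorder) : Prop :=
  forall lam : wellorder, is_regular_cardinal lam -> card_lt lam theta ->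
  exists S : set theta,
    [/\ stationary S,
        forall a, S a -> has_cofinality (seg a) lam
      & forall a : theta,
          is_limit_ordinal (seg a) -> uncountable_cofinality (seg a) ->
          ~ stationary [set x : seg a | S (val x)]].

End Ordinals.

Record language : Type := Language {
  fsym : Type;
  farity : fsym -> nat;
  rsym : Type;
  rarity : rsym -> nat }.

Record interp (L : language) (T : Type) : Type := Interp {
  fint : forall s : fsym L, ('I_(farity s) -> T) -> T;
  rint : forall r : rsym L, ('I_(rarity r) -> T) -> Prop }.

(* Structures live on subsets of an arbitrary type [V], standing for the universe
   of sets: substructures, unions of chains and isomorphic copies are then meant
   literally. *)
Record structure (L : language) (V : Type) : Type := Structure {
  dom : set V;
  str :> interp L dom }.

Section Structures.
Variables (L : language) (V : Type).
Implicit Types A B C U : structure L V.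

Definition has_card A (kappa : Type) : Prop := dom A #= [set: kappa].

Definition is_embedding A B (f : dom A -> dom B) : Prop :=
  [/\ injective f,
      forall (s : fsym L) (v : 'I_(farity s) -> dom A),
        f (fint A v) = fint B (f \o v)
    & forall (r : rsym L) (v : 'I_(rarity r) -> dom A),
        rint A v <-> rint B (f \o v)].

Definition is_iso A B (f : dom A -> dom B) : Prop :=
  is_embedding f /\ bijective f.

Definition isomorphic A B : Prop := exists f : dom A -> dom B, is_iso f.

Definition substructure A B : Prop :=
  exists2 f : dom A -> dom B, is_embedding f & forall a, val (f a) = val a.

Definition fixes A B C (f : dom B -> dom C) : Prop :=
  forall b, dom A (val b) -> val (f b) = val b.

Definition is_union (I : Type) (A : I -> structure L V) U : Prop :=
  dom U = \bigcup_i dom (A i) /\ forall i, substructure (A i) U.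

End Structures.

Section AbstractClasses.
Variables (L : language) (V : Type).
Variables (K : structure L V -> Prop).
Variables (le : structure L V -> structure L V -> Prop).
Implicit Types A B C U F : structure L V.

Record abstract_class : Prop := AbstractClass {
  le_dom : forall A B, le A B -> K A /\ K B;
  le_refl : forall A, K A -> le A A;
  le_antisym : forall A B, le A B -> le B A -> A = B;
  le_trans : forall A B C, le A B -> le B C -> le A C;
  K_iso : forall A B, isomorphic A B -> K A -> K B;
  le_iso : forall A B A' B' (g : dom A -> dom A') (f : dom B -> dom B'),
    is_iso g -> is_iso f ->
    (forall a b, val a = val b -> val (g a) = val (f b)) ->
    le A B -> le A' B';
  le_sub : forall A B, le A B -> substructure A B }.

Definition strong_embedding A B (f : dom A -> dom B) : Prop :=
  is_embedding f /\
  exists2 fA : structure L V, dom fA = range (fun a => val (f a)) & le fA B.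

Definition continuous_chain (D : wellorder) (A : D -> structure L V) : Prop :=
  [/\ forall i, K (A i),
      forall i j, wo_lt i j -> le (A i) (A j)
    & forall i, is_limit_ordinal (seg i) ->
        is_union (fun j : seg i => A (val j)) (A i)].

Record weak_AEC (mu : Type) : Prop := WeakAEC {
  wAEC_abstract : abstract_class;
  wAEC_union : forall (D : wellorder) (A : D -> structure L V) U,
    is_limit_ordinal D -> continuous_chain A -> is_union A U ->
    K U /\ forall i, le (A i) U;
  wAEC_LS_ge : [set: fsym L + rsym L + nat] #<= [set: mu];
  wAEC_LS : forall A (B : set V), K A -> B `<=` dom A ->
    exists C, [/\ K C, B `<=` dom C, le C A & dom C #<= [set: B + mu]] }.

(* The embedding of [B] into [C] is over [A]; otherwise any joint strong
   embedding of [A] and [B] would do. *)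
Definition coherent_le (mu : Type) A B : Prop :=
  [/\ K A, K B, substructure A B
    & exists C (f : dom B -> dom C),
      [/\ K C, has_card C (dom A + dom B + mu), le A C,
          strong_embedding f & fixes A f]].

Definition universal_over A B : Prop :=
  [/\ K A, K B
    & forall C, K C -> le A C -> dom C #= dom A ->
      exists2 f : dom C -> dom B, strong_embedding f & fixes A f].

Definition limit_over (kappa : Type) (delta : wellorder) A B : Prop :=
  exists N : delta -> structure L V,
    [/\ continuous_chain N,
        forall i, has_card (N i) kappa,
        forall i, is_zero i -> N i = A,
        is_union N B
      & forall i j, is_succ i j -> universal_over (N i) (N j)].

Definition categorical_model (kappa : Type) F : Prop :=
  [/\ K F, has_card F kappa
    & forall A, K A -> has_card A kappa -> isomorphic A F].

Record strongly_categorical (kappa kappa_succ : Type) : Prop :=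
  StronglyCategorical {
  sc_categorical : exists F, categorical_model kappa_succ F;
  sc_extension : forall A, K A -> has_card A kappa ->
    exists B, [/\ K B, has_card B kappa, B <> A & le A B];
  sc_universal : forall A, K A -> has_card A kappa ->
    exists B, has_card B kappa /\ universal_over A B }.

Definition CP (mu kappa : Type) (delta lam : wellorder) : Prop :=
  exists (A : lam -> structure L V) B,
    [/\ continuous_chain A /\ (forall i, has_card (A i) kappa),
        K B /\ has_card B kappa,
        forall i j, is_succ i j -> limit_over kappa delta (A i) (A j),
        forall i, limit_over kappa delta (A i) B
      & exists2 U, is_union A U & ~ coherent_le mu U B].

End AbstractClasses.

(* The logic L_{oo,theta}, in well-scoped syntax: [formula theta X] consists of
   the formulas with free variables in [X].  Conjunctions are over arbitrary
   index types, and [FEx] quantifies a block of variables indexed by a type [Y]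
   of cardinality less than [theta]. *)
Section Logic.
Variables (L : language) (theta : Type).

Inductive term (X : Type) : Type :=
| Var (x : X)
| App (s : fsym L) (t : 'I_(farity s) -> term X).

Inductive formula (X : Type) : Type :=
| FEq (t u : term X)
| FRel (r : rsym L) (t : 'I_(rarity r) -> term X)
| FNot (phi : formula X)
| FConj (J : Type) (phi : J -> formula X)
| FEx (Y : Type) of card_lt Y theta & formula (X + Y).

Definition sentence : Type := formula void.

Fixpoint eval (T : Type) (M : interp L T) (X : Type) (v : X -> T)
    (t : term X) : T :=
  match t with
  | Var x => v x
  | App s u => fint M (fun i => eval M v (u i))
  end.

Fixpoint sat (T : Type) (M : interp L T) (X : Type) (phi : formula X) :
    (X -> T) -> Prop :=
  match phi with
  | FEq t u => fun v => eval M v t = eval M v u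
  | FRel r t => fun v => rint M (fun i => eval M v (t i))
  | FNot phi => fun v => ~ sat M phi v
  | FConj J phi => fun v => forall j : J, sat M (phi j) v
  | FEx Y _ phi => fun v => exists w : Y -> T,
      sat M phi (fun z => match z with inl x => v x | inr y => w y end)
  end.

Definition models (T : Type) (M : interp L T) (phi : sentence) : Prop :=
  sat M phi (fun x : void => match x with end).

Definition Linf_equiv (T U : Type) (M : interp L T) (N : interp L U) : Prop :=
  forall phi : sentence, models M phi <-> models N phi.

Definition axiomatisable (V : Type) (K : structure L V -> Prop) : Prop :=
  exists Phi : sentence -> Prop,
    forall M : structure L V, K M <-> forall phi, Phi phi -> models M phi.

End Logic.

(* L_{oo,theta}-freeness, where [theta] is kappa^+. *)
Definition Linf_free (L : language) (V : Type) (K : structure L V -> Prop)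
    (theta : Type) (M : structure L V) : Prop :=
  exists2 F, categorical_model K theta F & Linf_equiv theta M F.

(* Main.v *)
Require Import Defs.
From mathcomp Require Import all_boot.
From mathcomp Require Import boolp classical_sets functions cardinality
  wochoice.

(* Write theta for kappa^+ and let S be a non-reflecting stationary set of
   ordinals of cofinality lam below theta.  Build a continuous increasing chain
   (M_i), i < theta, of models of size kappa in which M_i is strong in every
     later
   M_j as soon as i is not in S, and every M_(i+1) is a (kappa,
     delta)-limit over
   the M_j with j <= i outside S.  Limit stages are in K because S does not
   reflect: a club of i avoids S, and along it the chain is a strong chain.  At
   i in S, a continuous cofinal sequence of type lam outside S makes M_i
   isomorphic to the union of the chain given by CP, by uniqueness of limit
   models, and M_(i+1) is taken to be a copy of the model B of CP,
     so that M_i is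
   not coherently strong in M_(i+1).

   The union M is not isomorphic to F: otherwise M would also be the union of a
   continuous strong chain (N_i), and N_i = M_i for i in a club, hence for some
   i in S; choosing j > i in the club, M_j would witness that M_i is coherently
   strong in M_(i+1).  On the other hand M and F are both filtered by models
   of size kappa with universal extensions inside the filtration, so that a back
   and forth between small strong pieces shows their L_(oo,theta)-equivalence.
     *)

Set Implicit Arguments.
Unset Strict Implicit.
Unset Printing Implicit Defensive.

Local Open Scope classical_set_scope.
Local Open Scope card_scope.

(** * Cardinal arithmetic *)

(** The obstacle is that for i in S the model M_i is not strong in M_(i+1), so the union axiom does
    not apply to the chain as it stands, and the final M lies outside K. Hence strength is only ever
    asked between small stages, never between a stage and M, and each limit stage is reached along
    indices outside S.

    What fails at S must be coherent strength: at the end M_i and M_(i+1) are both seen to be strong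
    in one M_j, and in a class without a coherence axiom this does not make M_i strong in M_(i+1).

    Amalgamation is not assumed. In size kappa it is extracted from the existence of universal
    extensions, and it is what lets a limit model over a stage serve as a limit model over every
    smaller strong stage.

    F is represented by the union of a chain of universal extensions of length kappa^+ that starts,
    like (M_i), at the first model of CP; the identity of that model starts the back and forth.

    Copies of structures are literal subsets of V. Since V carries a model of size kappa^+, it
    always has room for another kappa points. *)

Lemma rel_card_le (T U : Type) (A : set T) (B : set U) (R : T -> U -> Prop) :
  (forall x, A x -> exists2 y, B y & R x y) ->
  (forall x x' y, A x -> A x' -> R x y -> R x' y -> x = x') -> A #<= B.
Proof.
move=> tot inj.
have tot' (a : A) : exists b : B, R (val a) (val b).
  have [y By Ry] := tot _ (set_mem (valP a)).
  by exists (SigSub (mem_set By)).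
have [f fP] := choice tot'.
apply/card_leP/injfunPex; exists f => // a a' _ _ E; apply: val_inj.
apply: (inj _ _ (val (f a)));
  [exact: set_mem (valP a)|exact: set_mem (valP a')| |].
  exact: fP.
by rewrite E; exact: fP.
Qed.

Lemma fun_card_le (T U : Type) (A : set T) (B : set U) (f : T -> U) :
  (forall x, A x -> B (f x)) ->
  (forall x x', A x -> A x' -> f x = f x' -> x = x') -> A #<= B.
Proof.
move=> fAB finj; apply: (@rel_card_le _ _ _ _ (fun x y => f x = y)).
  by move=> x Ax; exists (f x) => //; exact: fAB.
by move=> x x' y Ax Ax' E E'; apply: finj => //; rewrite E E'.
Qed.

(** Comparisons of sets are turned into total functions, with [u0] as the irrelevant value off [A],
    so that later codings need no subset types. *)
Lemma card_le_fun (T U : Type) (u0 : U) (A : set T) (B : set U) :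
  A #<= B -> exists f : T -> U, (forall x, A x -> B (f x)) /\
    (forall x x', A x -> A x' -> f x = f x' -> x = x').
Proof.
move=> /card_leP/injfunPex[f _ finj].
have /choice[g gP] : forall x, exists y : U,
    forall h : A x, y = val (f (SigSub (mem_set h))).
  move=> x; have [h|h] := pselect (A x); last by exists u0.
  by exists (val (f (SigSub (mem_set h)))) => h';
    rewrite (Prop_irrelevance h h').
exists g; split=> [x Ax|x x' Ax Ax'].
  by rewrite (gP x Ax); apply: set_mem; exact: valP.
rewrite (gP x Ax) (gP x' Ax') => /val_inj E.
by have := finj _ _ (in_setT _) (in_setT _) E; case.
Qed.

Lemma set_type_card (T : Type) (A : set T) : [set: set_type A] #= A.
Proof. exact: card_setT. Qed.

(** Zorn's lemma for partial injections between [A] and [B]: if a maximal one missed a point on each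
    side, that pair could be added to it. *)
Lemma card_le_total (T U : Type) (A : set T) (B : set U) :
  A #<= B \/ B #<= A.
Proof.
pose P (G : set (T * U)) := [/\ forall x y, G (x, y) -> A x /\ B y,
   forall x y y', G (x, y) -> G (x, y') -> y = y'
 & forall x x' y, G (x, y) -> G (x', y) -> x = x'].
have [|G [[GAB Gf Gi] Gmax]] := @Zorn_bigcup _ P.
  move=> F FP tot.
  have two p q : (\bigcup_(X in F) X) p -> (\bigcup_(X in F) X) q ->
      exists2 G, F G & G p /\ G q.
    move=> [X FX Xp] [Y FY Yq]; have [XY|YX] := tot _ _ FX FY.
      by exists Y => //; split=> //; exact: XY.
    by exists X => //; split=> //; exact: YX.
  split.
  - by move=> x y [X /FP[+ _ _]]; apply.
  - by move=> x y y' /two h /h[X /FP[_ + _] []]; apply.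
  - by move=> x x' y /two h /h[X /FP[_ _ +] []]; apply.
have [hA|/existsNP[x /not_implyP[Ax nx]]] :=
    pselect (forall x, A x -> exists y, G (x, y)).
  left; apply: (@rel_card_le _ _ _ _ (fun x y => G (x,
    y))) => [x Ax|x x' y _ _].
    by have [y Gxy] := hA x Ax; exists y => //; case: (GAB _ _ Gxy).
  exact: Gi.
have [hB|/existsNP[y /not_implyP[By ny]]] :=
    pselect (forall y, B y -> exists x, G (x, y)).
  right; apply: (@rel_card_le _ _ _ _ (fun y x => G (x,
    y))) => [z Bz|z z' t _ _].
    by have [t Gtz] := hB z Bz; exists t => //; case: (GAB _ _ Gtz).
  exact: Gf.
exfalso; apply: (Gmax (G `|` [set (x, y)])).
  split=> [|sub]; first by move=> p; left.
  by apply: nx; exists y; apply: sub; right.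
split.
- by move=> x' y' [/GAB//|[-> ->]].
- move=> x' y1 y2 [g1|[e1 e2]] [g2|[e3 e4]]; first exact: Gf g1 g2.
  + by exfalso; apply: nx; exists y1; rewrite -e3.
  + by exfalso; apply: nx; exists y2; rewrite -e1.
  + by rewrite e2 e4.
- move=> x1 x2 y' [g1|[e1 e2]] [g2|[e3 e4]]; first exact: Gi g1 g2.
  + by exfalso; apply: ny; exists x1; rewrite -e4.
  + by exfalso; apply: ny; exists x2; rewrite -e2.
  + by rewrite e1 e3.
Qed.

Section Hessenberg.
Variable T : Type.
Hypothesis Tinf : [set: nat] #<= [set: T].
Implicit Types (G : set (T * T * T)) (x y z : T).

Let field G : set T := [set x | exists z, G (x, x, z)].

Let pairing G := [/\ forall p z z', G (p, z) -> G (p, z') -> z = z',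
  forall p p' z, G (p, z) -> G (p', z) -> p = p',
  forall x y z, G (x, y, z) -> [/\ field G x, field G y & field G z]
& forall x y, field G x -> field G y -> exists z, G (x, y, z)].

(* Zorn's lemma gives a maximal set [A] with an injection of [A * A] into [A];
   were [T \ A] at least as large as [A], the injection could be extended. *)
Lemma card_square : [set: T * T] #<= [set: T].
Proof.
have [e einj] : exists e : nat -> T, injective e.
  move: Tinf => /card_leP/injfunPex[f _ fi].
  exists (fun n => val (f (SigSub (in_setT n)))) => n m /val_inj E.
  by have := fi _ _ (in_setT _) (in_setT _) E; case.
(* The family given to [Zorn_bigcup] must contain the union of the empty chain, so maximality is
   sought among the [G] for which [G0] together with [G] is a pairing. The copy of the pairing of
   [nat] thus survives, and the field of the maximal one contains the two tags [e 0] and [e 1]. *)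
pose G0 : set (T * T * T) :=
  [set q | exists n m : nat, q = (e n, e m, e (pickle (n, m)))].
have pickle_inj (n m n' m' : nat) : pickle (n, m) = pickle (n', m') ->
    n = n' /\ m = m'.
  by move/(pcan_inj pickleK) => [-> ->].
have field0 n : field G0 (e n) by exists (e (pickle (n, n))), n, n.
pose P G := pairing (G0 `|` G).
have P0 : P set0.
  rewrite /P setU0; split.
  - by move=> p z z' [n [m [-> ->]]] [n' [m' [/einj -> /einj -> ->]]].
  - by move=> p p' z [n [m [-> ->]]] [n' [m' [-> /einj/pickle_inj[-> ->]]]].
  - by move=> x y z [n [m [-> -> ->]]].
  - move=> x y [_ [n [_ [-> _ _]]]] [_ [m [_ [-> _ _]]]].
    by exists (e (pickle (n, m))), n, m.
have [|G [PG Gmax]] := @Zorn_bigcup _ P.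
  move=> F FP tot; rewrite /P; set H := G0 `|` _.
  have two p q : H p -> H q -> exists G, [/\ P G, G0 `|` G `<=` H,
      (G0 `|` G) p & (G0 `|` G) q].
    have subF X : F X -> G0 `|` X `<=` H.
      by move=> FX r [|Xr]; [left|right; exists X].
    move=> [Gp|[X FX Xp]] [Gq|[Y FY Yq]].
    - by exists set0; split=> //; rewrite ?setU0 //; left.
    - by exists Y; split; [exact: FP|exact: subF|left|right].
    - by exists X; split; [exact: FP|exact: subF|right|left].
    - have [XY|YX] := tot _ _ FX FY.
        by exists Y; split; [exact: FP|exact: subF|right; exact: XY|right].
      by exists X; split; [exact: FP|exact: subF|right|right; exact: YX].
  have fsub G x : G `<=` H -> field G x -> field H x.
    by move=> GH [z Gz]; exists z; apply: GH.
  split.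
  - by move=> p z z' /two h /h[G [[Gf _ _ _] _ g1 g2]]; exact: Gf g1 g2.
  - by move=> p p' z /two h /h[G [[_ Gi _ _] _ g1 g2]]; exact: Gi g1 g2.
  - move=> x y z h; have [G [[_ _ Gc _] GH g _]] := two _ _ h h.
    by have [fx fy fz] := Gc _ _ _ g; split; exact: fsub GH _.
  - move=> x y [u xu] [v yv]; have [G [[_ _ _ Gt] GH gx gy]] := two _ _ xu yv.
    have [z Gz] := Gt x y (ex_intro _ u gx) (ex_intro _ v gy).
    by exists z; apply: GH.
move: PG; rewrite /P; set G1 := G0 `|` G => PG.
have {Gmax} Gmax G' : G1 `<=` G' -> pairing G' -> G' `<=` G1.
  move=> sub pG'; apply: contrapT => nsub.
  have E : G0 `|` (G' `|` G) = G'.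
    apply/seteqP; split=> q; last by move=> ?; right; left.
    by case=> [h|[//|h]]; apply: sub; [left|right].
  apply: (Gmax (G' `|` G)); last by rewrite /P E.
  split=> [q Gq|sub']; first by right.
  by apply: nsub => q G'q; right; apply: sub'; left.
case: PG => Gf Gi Gc Gt; pose A := field G1.
have [g gP] : exists g : T -> T -> T, forall x y, A x -> A y -> G1 (x, y,
  g x y).
  have /choice[g gP] : forall p : T * T, exists z,
      A p.1 -> A p.2 -> G1 (p.1, p.2, z).
    move=> [x y]; have [[Ax Ay]|h] := pselect (A x /\ A y).
      by have [z] := Gt _ _ Ax Ay; exists z.
    by exists x => Ax Ay; exfalso; exact: h.
  by exists (fun x y => g (x, y)) => x y Ax Ay; exact: (gP (x, y)).
have gA x y : A x -> A y -> A (g x y) by move=> Ax /(gP _ _ Ax)/Gc[].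
have gi x y x' y' : A x -> A y -> A x' -> A y' -> g x y = g x' y' ->
    x = x' /\ y = y'.
  move=> Ax Ay Ax' Ay' E; have := gP _ _ Ax Ay; rewrite E => h.
  by have [-> ->] := Gi _ _ _ h (gP _ _ Ax' Ay').
have Ae n : A (e n) by exists (e (pickle (n, n))); left; exists n, n.
have e01 : e 0 <> e 1 by move/einj.
(* If the complement injects into [A], so does all of [T]: [g (e 0)] and [g (e 1)] have disjoint
   ranges inside [A], one receiving [A] and the other the image of the complement. *)
have [le|le] := card_le_total (~` A) A.
  have [r [rA ri]] := card_le_fun (e 0) le.
  pose c x := if pselect (A x) then g (e 0) x else g (e 1) (r x).
  have cA x : A (c x) by rewrite /c; case: pselect => h; apply: gA => //;
    exact: rA.
  have ci x y : c x = c y -> x = y.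
    rewrite /c; case: pselect => hx; case: pselect => hy E.
    - by have [] := gi _ _ _ _ (Ae 0) hx (Ae 0) hy E.
    - by have [] := gi _ _ _ _ (Ae 0) hx (Ae 1) (rA _ hy) E.
    - by have [/esym] := gi _ _ _ _ (Ae 1) (rA _ hx) (Ae 0) hy E.
    - have [_] := gi _ _ _ _ (Ae 1) (rA _ hx) (Ae 1) (rA _ hy) E; exact: ri.
  apply: (@fun_card_le _ _ _ _ (fun p => g (c p.1) (c p.2))) => // -[x y] [x'
    y'] _ _.
  by move=> /(gi _ _ _ _ (cA _) (cA _) (cA _) (cA _))[/ci/= -> /ci/= ->].
have [r [rA ri]] := card_le_fun (e 0) le.
pose B : set T := r @` A.
have /choice[s sP] : forall y, exists x, B y -> A x /\ r x = y.
  move=> y; have [[x Ax <-]|h] := pselect (B y); first by exists x.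
  by exists y.
pose c x := if pselect (A x) then g (e 0) x else g (e 1) (s x).
have cA x : A x \/ B x -> A (c x).
  rewrite /c; case: pselect => h; first by move=> _; exact: gA.
  by case=> // /sP[? _]; exact: gA.
have ci x y : A x \/ B x -> A y \/ B y -> c x = c y -> x = y.
  rewrite /c; case: pselect => hx; case: pselect => hy.
  - by move=> _ _ /(gi _ _ _ _ (Ae 0) hx (Ae 0) hy)[].
  - by move=> _ [//|/sP[sy _]] /(gi _ _ _ _ (Ae 0) hx (Ae 1) sy)[].
  - by move=> [//|/sP[sx _]] _ /(gi _ _ _ _ (Ae 1) sx (Ae 0) hy)[/esym].
  - move=> [//|/sP[sx e1]] [//|/sP[sy e2]] /(gi _ _ _ _ (Ae 1) sx (Ae 1) sy)[_
      E].
    by rewrite -e1 -e2 E.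
(* [B] is a copy of [A] disjoint from it, and [c] injects their union into [A] by tagging. The pairs
   not inside [A] get values in [B], so they cannot collide with the old values, which lie in
   [A]. *)
pose N : set (T * T * T) := [set q | exists x y,
  [/\ A x \/ B x, A y \/ B y, ~ (A x /\ A y) & q = (x, y, r (g (c x) (c y)))]].
have NB x y z : N (x, y, z) -> B z.
  move=> [x' [y' [hx hy _ [_ _ ->]]]]; exists (g (c x') (c y')) => //.
  by apply: gA; exact: cA.
have BnA x : B x -> ~ A x by move=> [y Ay <-]; exact: rA.
have fieldE x : field (G1 `|` N) x = (A x \/ B x).
  apply/propext; split=> [[z [h|[x' [y' [hx _ _ [-> _]]]]]]|[[z Gz]|Bx]] //.
  - by left; exists z.
  - by exists z; left.
  - exists (r (g (c x) (c x))); right; exists x, x; split;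
      [by right|by right| |by []].
    by case=> /(BnA _ Bx).
have sub : G1 `|` N `<=` G1.
  apply: Gmax => [q|]; first by left.
  split.
  - move=> [x y] z z' [g1|n1] [g2|n2].
    + exact: Gf g1 g2.
    + by case: n2 => x' [y' [_ _ nA [E1 E2 _]]]; case: nA; rewrite -E1 -E2;
        have [] := Gc _ _ _ g1.
    + by case: n1 => x' [y' [_ _ nA [E1 E2 _]]]; case: nA; rewrite -E1 -E2;
        have [] := Gc _ _ _ g2.
    + case: n1 => x1 [y1 [_ _ _ [e1 e2 ->]]];
        case: n2 => x2 [y2 [_ _ _ [e3 e4 ->]]].
      by rewrite -e1 -e2 -e3 -e4.
  - move=> [x y] [x' y'] z [g1|n1] [g2|n2].
    + exact: Gi g1 g2.
    + by have [_ _ /(BnA _ (NB _ _ _ n2))] := Gc _ _ _ g1.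
    + by have [_ _ /(BnA _ (NB _ _ _ n1))] := Gc _ _ _ g2.
    + case: n1 => x1 [y1 [hx1 hy1 _ [-> -> ez]]].
      case: n2 => x2 [y2 [hx2 hy2 _ [-> -> E]]]; rewrite ez in E.
      have [a1 b1 a2 b2] := And4 (cA _ hx1) (cA _ hy1) (cA _ hx2) (cA _ hy2).
      have [E1 E2] := gi _ _ _ _ a1 b1 a2 b2 (ri _ _ (gA _ _ a1 b1) (gA _ _ a2
        b2) E).
      by rewrite (ci _ _ hx1 hx2 E1) (ci _ _ hy1 hy2 E2).
  - move=> x y z [/Gc[? ? ?]|n1]; first by rewrite !fieldE; split; left.
    have Bz := NB _ _ _ n1; rewrite !fieldE.
    by case: n1 => x1 [y1 [hx1 hy1 _ [-> -> _]]]; split=> //; right.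
  - move=> x y; rewrite !fieldE => hx hy.
    have [[Ax Ay]|nA] := pselect (A x /\ A y); first by have [z ?] :=
      Gt _ _ Ax Ay; exists z; left.
    by exists (r (g (c x) (c y))); right; exists x, y.
have Br : B (r (e 0)) by exists (e 0).
have : field (G1 `|` N) (r (e 0)) by rewrite fieldE; right.
by move=> [z /sub Gz]; case: (BnA _ Br); exists z.
Qed.
End Hessenberg.

Section InfiniteCardinal.
Variable kappa : Type.
Hypothesis kinf : [set: nat] #<= [set: kappa].

Lemma kappa_point : exists k : kappa, True.
Proof.
by move: kinf => /card_leP[f]; exists (val (f (SigSub (in_setT 0)))).
Qed.

(** A point is coded by an index and its place in that member; as it may lie in several members, the
    coding is a relation and not a function. *)
Lemma bigcup_card_le (I T : Type) (J : set I) (F : I -> set T) :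
  J #<= [set: kappa] -> (forall i, J i -> F i #<= [set: kappa]) ->
  \bigcup_(i in J) F i #<= [set: kappa].
Proof.
have [k0 _] := kappa_point => Jk Fk; have [j [_ ji]] := card_le_fun k0 Jk.
have /choice[f fP] : forall i, exists f : T -> kappa,
    J i -> forall x x', F i x -> F i x' -> f x = f x' -> x = x'.
  move=> i; have [/Fk/(card_le_fun k0)[f [_ fi]]|h] := pselect (J i);
    first by exists f.
  by exists (fun=> k0).
apply: card_le_trans (card_square kinf).
apply: (@rel_card_le _ _ _ _ (fun x p =>
    exists i, [/\ J i, F i x & p = (j i, f i x)])).
  by move=> x [i Ji Fx]; exists (j i, f i x) => //; exists i.
move=> x x' p _ _ [i [Ji Fx ->]] [i' [Ji' Fx' []]] /ji E.
by rewrite -E // in Fx' *; exact: fP.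
Qed.

Lemma setU_card_le (T : Type) (A B : set T) :
  A #<= [set: kappa] -> B #<= [set: kappa] -> A `|` B #<= [set: kappa].
Proof.
move=> Ak Bk; have -> : A `|` B = \bigcup_(b in [set: bool]) (if b then A else
  B).
  apply/seteqP; split=> x; first by case=> h; [exists true|exists false].
  by case=> -[] _ h; [left|right].
apply: bigcup_card_le => [|[]//]; apply: card_le_trans kinf.
by apply: (@fun_card_le _ _ _ _ nat_of_bool) => // -[] [].
Qed.

Lemma sum_card_le (T U : Type) :
  [set: T] #<= [set: kappa] -> [set: U] #<= [set: kappa] ->
  [set: T + U] #<= [set: kappa].
Proof.
move=> Tk Uk; have -> : [set: T + U] = range inl `|` range inr.
  by apply/seteqP; split=> // -[x|x] _; [left; exists x|right; exists x].
by apply: setU_card_le; apply: card_le_trans (card_image_le _ _) _.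
Qed.
End InfiniteCardinal.

(** * Well-orders *)

Definition to_seg (W : wellorder) (a x : W) (xa : wo_lt x a) : seg a :=
  SigSub (mem_set (xa : [set y | wo_lt y a] x)).

Lemma seg_val_lt (W : wellorder) (a : W) (x : seg a) : wo_lt (val x) a.
Proof. exact: set_mem (valP x). Qed.

Section WellOrder.
Variable W : wellorder.
Implicit Types (x y z i j : W) (X C : set W).

Lemma wo_min X : X !=set0 -> exists2 m, X m & forall x, X x -> wo_le m x.
Proof.
move=> [x Xx]; have [|m [[Am lbm] _]] := @wo_leP W (mem X).
  by exists x; apply/mem_set.
by exists m => [|y Xy]; [exact: set_mem|apply: lbm; exact/mem_set].
Qed.

Lemma wo_total x y : wo_le x y \/ wo_le y x.
Proof.
have [|m [->|->] lb] := @wo_min [set x; y]; first by exists x; left.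
  by left; apply: lb; right.
by right; apply: lb; left.
Qed.

Lemma wo_le_trans x y z : wo_le x y -> wo_le y z -> wo_le x z.
Proof.
move=> xy yz; have [|m mE lb] := @wo_min [set u | u = x \/ u = y \/ u = z].
  by exists x; left.
case: mE => [<-|[E|E]]; first by apply: lb; right; right.
  have -> // : x = y by apply: wo_anti => //; rewrite -E; apply: lb; left.
have E' : y = z by apply: wo_anti => //; rewrite -E; apply: lb; right; left.
by rewrite -E'.
Qed.

Lemma wo_ltW x y : wo_lt x y -> wo_le x y. Proof. by case. Qed.

Lemma wo_ltnn x : ~ wo_lt x x. Proof. by case. Qed.

Lemma wo_lt_le_trans x y z : wo_lt x y -> wo_le y z -> wo_lt x z.
Proof.
move=> [xy nxy] yz; split; first exact: wo_le_trans xy yz.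
by move=> E; apply: nxy; apply: wo_anti => //; rewrite E.
Qed.

Lemma wo_le_lt_trans x y z : wo_le x y -> wo_lt y z -> wo_lt x z.
Proof.
move=> xy [yz nyz]; split; first exact: wo_le_trans xy yz.
by move=> E; apply: nyz; apply: wo_anti => //; rewrite -E.
Qed.

Lemma wo_lt_trans x y z : wo_lt x y -> wo_lt y z -> wo_lt x z.
Proof. by move=> xy /wo_ltW; exact: wo_lt_le_trans. Qed.

Lemma wo_nle x y : ~ wo_le x y -> wo_lt y x.
Proof.
move=> nxy; have [//|yx] := wo_total x y; split=> // E; apply: nxy.
by rewrite E; exact: wo_refl.
Qed.

Lemma wo_nlt x y : ~ wo_lt x y -> wo_le y x.
Proof. by move=> nxy; apply: contrapT => /wo_nle. Qed.

Lemma wo_lt_nle x y : wo_lt x y -> ~ wo_le y x.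
Proof. by move=> xy /(wo_lt_le_trans xy)/wo_ltnn. Qed.

Lemma wo_le_eqVlt x y : wo_le x y -> x = y \/ wo_lt x y.
Proof. by move=> xy; have [->|n] := pselect (x = y); [left|right]. Qed.

Lemma wo_ind (P : W -> Prop) :
  (forall x, (forall y, wo_lt y x -> P y) -> P x) -> forall x, P x.
Proof.
move=> IH x; apply: contrapT => nPx.
have [|m nPm lb] := @wo_min [set u | ~ P u]; first by exists x.
by apply: nPm; apply: IH => y ym; apply: contrapT => /lb; exact: wo_lt_nle.
Qed.

Lemma wo_wf : well_founded (@wo_lt W).
Proof. by move=> x; elim/wo_ind: x => x IH; constructor. Qed.

(* The value at [i] is chosen after, and may depend on, the values below [i]. *)
Lemma wo_recursion (T : Type) (t0 : T) (P : W -> (W -> T) -> T -> Prop) :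
  (forall i g g' t, (forall j,
    wo_lt j i -> g j = g' j) -> P i g t -> P i g' t) ->
  (forall i g, (forall j, wo_lt j i -> P j g (g j)) -> exists t, P i g t) ->
  exists g, forall i, P i g (g i).
Proof.
move=> Ploc Pex.
have /choice[F FP] : forall ig : W * (W -> T), exists t,
    (exists s, P ig.1 ig.2 s) -> P ig.1 ig.2 t.
  move=> ig; have [[s Ps]|h] := pselect (exists s, P ig.1 ig.2 s).
    by exists s.
  by exists t0.
pose ext i (h : forall j, wo_lt j i -> T) j :=
  if pselect (wo_lt j i) is left ji then h j ji else t0.
pose g := Fix wo_wf (fun=> T) (fun i h => F (i, ext i h)).
have gE i : g i = F (i, ext i (fun j _ => g j)).
  rewrite /g Fix_eq // => x h h' hh'; congr (F (_, ext x _)).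
  by apply: functional_extensionality_dep => j; apply: funext => ji; exact: hh'.
exists g; elim/wo_ind => i IH.
have extg j : wo_lt j i -> ext i (fun j _ => g j) j = g j.
  by move=> ji; rewrite /ext; case: pselect.
have [t Pt] := Pex i g IH.
have h : exists s, P i (ext i (fun j _ => g j)) s.
  by exists t; apply: Ploc Pt => j /extg.
apply: (Ploc i (ext i (fun j _ => g j))) => //.
by rewrite gE; exact: (FP (i, _) h).
Qed.

(** The form internal to [W] avoids segments of segments; [is_limitE] and [is_limit_seg]
    translate. *)
Definition is_limit x := (exists y, wo_lt y x) /\
  forall y, wo_lt y x -> exists2 z, wo_lt y z & wo_lt z x.

Lemma is_limitE x : is_limit_ordinal (seg x) <-> is_limit x.
Proof.
split.
  move=> [[[y yx]] nomax]; split; first by exists y; exact: set_mem.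
  move=> z zx; have [[u ux] [/= zu nzu]] := nomax (to_seg zx).
  exists u; last exact: set_mem.
  by split=> // E; apply: nzu; apply: val_inj.
move=> [[y yx] nomax]; split; first by constructor; exact: (to_seg yx).
move=> [z zx]; have [u zu ux] := nomax z (set_mem zx).
exists (to_seg ux); split; first exact: wo_ltW.
by move=> E; case: zu => _; apply; move: E => /(congr1 val).
Qed.

Lemma zero_succ_limit x :
  [\/ is_zero x, exists y, is_succ y x | is_limit x].
Proof.
have [z|/existsNP[y /contrapT yx]] := pselect (is_zero x);
  first by constructor 1.
have [l|] := pselect (is_limit x); first by constructor 3.
move=> /not_andP[]; first by case; exists y.
move=> /existsNP[u /not_implyP[ux nu]]; constructor 2; exists u;
  split=> // z [uz zx].
by apply: nu; exists z.
Qed.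

Lemma zero_uniq x y : is_zero x -> is_zero y -> x = y.
Proof.
by move=> zx zy; apply: wo_anti; apply: wo_nlt; [exact: zx|exact: zy].
Qed.

Lemma zero_le x y : is_zero x -> wo_le x y.
Proof. by move=> zx; apply: wo_nlt; exact: zx. Qed.

Lemma succ_le x y z : is_succ x y -> wo_lt z y -> wo_le z x.
Proof. by move=> [xy nz] zy; apply: wo_nlt => xz; apply: (nz z). Qed.

Lemma succ_lt x y z : is_succ x y -> wo_lt x z -> wo_le y z.
Proof. by move=> [xy nz] xz; apply: wo_nlt => zy; apply: (nz z). Qed.

Lemma succ_inj x x' y : is_succ x y -> is_succ x' y -> x = x'.
Proof.
move=> s s'; apply: wo_anti; first by apply: (succ_le s'); case: s.
by apply: (succ_le s); case: s'.
Qed.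

Lemma succ_not_zero x y : is_succ x y -> ~ is_zero y.
Proof. by move=> [xy _] /(_ x). Qed.

Lemma succ_not_limit x y : is_succ x y -> ~ is_limit y.
Proof. by move=> [xy nz] [_ /(_ _ xy)[z xz zy]]; apply: (nz z). Qed.

Lemma limit_not_zero x : is_limit x -> ~ is_zero x.
Proof. by move=> [[y yx] _] /(_ y). Qed.

Lemma exists_zero (x : W) : exists z : W, is_zero z.
Proof.
have [|z _ lb] := @wo_min setT; first by exists x.
by exists z => y /wo_lt_nle; apply; exact: lb.
Qed.

Lemma exists_succ x y : wo_lt x y -> exists2 z, is_succ x z & wo_le z y.
Proof.
move=> xy; have [|z xz lb] := @wo_min [set u | wo_lt x u]; first by exists y.
by exists z; [split=> // u [/lb zu /wo_lt_nle]; apply|exact: lb].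
Qed.

Lemma limit_succ x y : is_limit x -> wo_lt y x -> exists2 z,
  is_succ y z & wo_lt z x.
Proof.
move=> [_ lx] /lx[u yu ux]; have [z yz zu] := exists_succ yu.
by exists z => //; exact: wo_le_lt_trans zu ux.
Qed.

(** The bound is strict: when [X] has a maximum, [s] is its successor. [lub_limit] treats the other
    case. *)
Lemma exists_lub X b : (forall x, X x -> wo_lt x b) ->
  exists s, [/\ forall x, X x -> wo_lt x s, wo_le s b &
    forall y, wo_lt y s -> exists2 x, X x & wo_le y x].
Proof.
move=> Xb; have [|s Xs lb] := @wo_min [set u | forall x, X x -> wo_lt x u].
  by exists b.
exists s; split=> //; first exact: lb.
move=> y ys; apply: contrapT => h; apply: (wo_lt_nle ys); apply: lb => x Xx.
by apply: wo_nle => yx; apply: h; exists x.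
Qed.

Lemma lub_limit X s : X !=set0 -> (forall x, X x -> wo_lt x s) ->
  (forall y, wo_lt y s -> exists2 x, X x & wo_le y x) ->
  (forall x, X x -> exists2 x', X x' & wo_lt x x') -> is_limit s.
Proof.
move=> [x Xx] Xs cof nomax; split; first by exists x; exact: Xs.
move=> y /cof[u Xu yu]; have [v Xv uv] := nomax u Xu.
by exists v; [exact: wo_le_lt_trans yu uv|exact: Xs].
Qed.

(** The restricted order lets the union axiom, stated for chains indexed by a [wellorder], be used
    along a club without reindexing it by an ordinal. *)
Definition sub_sort C : Type := set_type C.

Definition sub_le C : rel (sub_sort C) := fun u v => wo_le (val u) (val v).

Lemma sub_leP C : well_order (@sub_le C).
Proof.
move=> A [x Ax].
have [|m [z Az zm] lb] := @wo_min [set y | exists2 u, u \in A & val u = y].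
  by exists (val x), x.
have lbz : lower_bound (@sub_le C) A z.
  by move=> y Ay; rewrite /sub_le zm; apply: lb; exists y.
exists z; split=> // z' [Az' lbz']; apply: val_inj; apply: wo_anti.
  exact: lbz.
exact: lbz'.
Qed.

Definition suborder C : wellorder := Wellorder (@sub_leP C).

Lemma suborder_lt C (u v : suborder C) : wo_lt u v <-> wo_lt (val u) (val v).
Proof.
split=> -[le ne]; split=> // E; apply: ne; first exact: val_inj.
by rewrite E.
Qed.

Lemma limit_ordinal_is_limit : is_limit_ordinal W ->
  forall x, exists y, is_succ x y.
Proof.
by move=> [_ h] x; have [y /exists_succ[z]] := h x; exists z.
Qed.

Lemma ordinal_bounded2 : is_limit_ordinal W ->
  forall x y, exists2 z, wo_lt x z & wo_lt y z.
Proof.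
move=> [_ h] x y; have [xy|yx] := wo_total x y.
  have [z yz] := h y; exists z => //; exact: wo_le_lt_trans xy yz.
have [z xz] := h x; exists z => //; exact: wo_le_lt_trans yx xz.
Qed.

End WellOrder.

Lemma seg_lt (W : wellorder) (a : W) (x y : seg a) :
  wo_lt x y <-> wo_lt (val x) (val y).
Proof.
split=> -[le ne]; split=> // E; apply: ne; first exact: val_inj.
by rewrite E.
Qed.

Lemma is_limit_seg (W : wellorder) (a : W) (x : seg a) :
  is_limit x <-> is_limit (val x).
Proof.
have xa := seg_val_lt x.
split=> -[[y yx] lx].
  split; first by exists (val y); apply/seg_lt.
  move=> z zx; have za := wo_lt_trans zx xa.
  have [|u /seg_lt zu /seg_lt ux] := lx (to_seg za); first exact/seg_lt.
  by exists (val u).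
split; first by exists (to_seg (wo_lt_trans yx xa)); apply/seg_lt.
move=> z /seg_lt/lx[u zu ux].
by exists (to_seg (wo_lt_trans ux xa)); apply/seg_lt.
Qed.

(** A maximum would be a cofinal singleton, and an empty order has an empty cofinal set; both are
    finite, against the infinity of [lam]. *)
Lemma cofinality_limit (W : wellorder) (lam : Type) :
  [set: nat] #<= [set: lam] -> has_cofinality W lam -> is_limit_ordinal W.
Proof.
move=> linf [[C Ccof CE] lmin].
have [c0 _] : C !=set0.
  apply/set0P/eqP => C0; apply: infinite_nat; apply: (@card_le_finite _ _ _ C).
    exact: card_le_trans linf (lmin _ Ccof).
  by rewrite C0; exact: finite_set0.
split; first by constructor.
move=> x; apply: contrapT => h; apply: infinite_nat.
apply: (@card_le_finite _ _ _ [set x]); last exact: finite_set1.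
apply: card_le_trans linf _; apply: lmin => y; exists x => //.
by apply: wo_nlt => xy; apply: h; exists y.
Qed.

Section SuccCardinal.
Variables (kappa : Type) (W : wellorder).
Hypothesis kinf : [set: nat] #<= [set: kappa].
Hypothesis Wsucc : is_succ_cardinal kappa W.

Lemma succ_card_le (T : Type) (A : set T) :
  ~ (A #<= [set: kappa]) -> [set: W] #<= A.
Proof.
move=> nA; case: Wsucc => _ _ /(_ (set_type A)) h.
apply: card_le_trans (h _) _; last by rewrite (card_le_eql (set_type_card A)).
have nA' : ~ ([set: set_type A] #<= [set: kappa]).
  by rewrite (card_le_eql (set_type_card A)).
by split=> //; have [] := card_le_total [set: kappa] [set: set_type A].
Qed.

Lemma succ_card_lt (T : Type) : card_lt T W -> [set: T] #<= [set: kappa].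
Proof.
move=> [_ nW]; apply: contrapT => nT; apply: nW; exact: succ_card_le.
Qed.

Lemma seg_card_le (a : W) : [set x | wo_lt x a] #<= [set: kappa].
Proof.
rewrite -(card_le_eql (set_type_card [set x | wo_lt x a])).
by apply: succ_card_lt; case: Wsucc => + _ _; exact.
Qed.

Lemma succ_card_not_le : ~ ([set: W] #<= [set: kappa]).
Proof. by case: Wsucc => _ []. Qed.

(** Regularity of kappa^+: an unbounded [X] of size at most kappa would cover [W] by kappa closed
    initial segments, each of size at most kappa. *)
Lemma succ_card_bounded (X : set W) : X #<= [set: kappa] ->
  exists b, forall x, X x -> wo_lt x b.
Proof.
move=> Xk; apply: contrapT => nb; apply: succ_card_not_le.
apply: (@card_le_trans _ _ _
    (\bigcup_(x in X) ([set y | wo_lt y x] `|` [set x]))).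
  apply: subset_card_le => y _; apply: contrapT => h; apply: nb;
    exists y => x Xx.
  apply: wo_nle => /wo_le_eqVlt yx; apply: h; exists x => //.
  by case: yx => [->|]; [right|left].
apply: bigcup_card_le => // x _; apply: setU_card_le => //;
  first exact: seg_card_le.
apply: card_le_trans kinf; exact: countable1.
Qed.

Lemma succ_card_limit : is_limit_ordinal W.
Proof.
have bd (X : set W) : X `<=` set0 \/ (exists x, X = [set x]) ->
    exists b, forall x, X x -> wo_lt x b.
  move=> h; apply: succ_card_bounded; apply: card_le_trans kinf.
  case: h => [X0|[x ->]]; last exact: countable1.
  have -> : X = set0 by apply/seteqP; split.
  exact: countable0.
split; first by have [b _] := bd set0 (or_introl (@subset_refl _ _)).
move=> x; have [|b bx] := bd [set x]; first by right; exists x.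
by exists b; exact: bx.
Qed.

End SuccCardinal.

(** * Maps between structures *)

Section StructureMaps.
Variables (L : language) (V : Type).
Implicit Types (A B C U : structure L V) (f g h : V -> V) (x y : V).

Definition elt A x (Ax : dom A x) : dom A := SigSub (mem_set Ax).

Lemma elt_dom A (a : dom A) : dom A (val a).
Proof. exact: set_mem (valP a). Qed.

(* Maps between structures are total functions on [V], of which only the
   restriction to the domain matters. *)
Definition emb A B f : Prop :=
  exists2 g : dom A -> dom B, is_embedding g & forall a, val (g a) = f (val a).

Definition iso A B f : Prop :=
  emb A B f /\ forall y, dom B y -> exists2 x, dom A x & f x = y.

Lemma emb_dom A B f x : emb A B f -> dom A x -> dom B (f x).
Proof. by move=> [g _ gf] Ax; rewrite -(gf (elt Ax)); exact: elt_dom. Qed.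

Lemma emb_inj A B f x y :
  emb A B f -> dom A x -> dom A y -> f x = f y -> x = y.
Proof.
move=> [g [gi _ _] gf] Ax Ay; rewrite -(gf (elt Ax)) -(gf (elt Ay)).
by move=> /val_inj/gi; case.
Qed.

Lemma emb_fun A B f (s : Defs.fsym L) (v : 'I_(farity s) -> dom A) w : emb A B f
  ->
  (forall i, val (w i) = f (val (v i))) -> val (fint B w) = f (val (fint A v)).
Proof.
move=> [g [_ gF _] gf] wv; rewrite -gf gF; congr (val (fint B _)).
by apply: funext => i; apply: val_inj; rewrite wv -gf.
Qed.

Lemma emb_rel A B f (r : rsym L) (v : 'I_(rarity r) -> dom A) w : emb A B f ->
  (forall i, val (w i) = f (val (v i))) -> rint A v <-> rint B w.
Proof.
move=> [g [_ _ gR] gf] wv; rewrite gR; suff -> : w = g \o v by [].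
by apply: funext => i; apply: val_inj; rewrite wv -gf.
Qed.

Lemma emb_intro A B f :
  (forall x, dom A x -> dom B (f x)) ->
  (forall x y, dom A x -> dom A y -> f x = f y -> x = y) ->
  (forall (s : Defs.fsym L) (v : 'I_(farity s) -> dom A) w,
    (forall i, val (w i) = f (val (v i))) -> val (fint B w) = f (val (fint A
      v))) ->
  (forall (r : rsym L) (v : 'I_(rarity r) -> dom A) w,
    (forall i, val (w i) = f (val (v i))) -> rint A v <-> rint B w) ->
  emb A B f.
Proof.
move=> fD fi fF fR; exists (fun a => elt (fD _ (elt_dom a))) => //; split.
- by move=> a b /(congr1 val)/= /fi E; apply: val_inj; apply: E; exact: elt_dom.
- by move=> s v; apply: val_inj; apply: esym; exact: fF.
- by move=> r v; exact: fR.
Qed.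

Lemma emb_ext A B f g :
  (forall x, dom A x -> f x = g x) -> emb A B f -> emb A B g.
Proof.
by move=> fg [h hE hf]; exists h => // a; rewrite hf fg //; exact: elt_dom.
Qed.

Lemma emb_id A : emb A A id.
Proof.
by exists id => //; split.
Qed.

Lemma emb_comp A B C f g : emb A B f -> emb B C g -> emb A C (g \o f).
Proof.
move=> [f' [fi fF fR] ff] [g' [gi gF gR] gg]; exists (g' \o f'); last first.
  by move=> a; rewrite /= gg ff.
split; first exact: inj_comp.
  by move=> s v; rewrite /= fF gF.
by move=> r v; rewrite fR gR.
Qed.

(** Cancelling an embedding on the left yields both the inverses of isomorphisms and the inclusions
    between substructures of a common structure. *)
Lemma emb_cancel A B C f g h : emb A C h -> emb B C g ->
  (forall x, dom A x -> dom B (f x)) -> (forall x, dom A x -> h x = g (f x)) ->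
  emb A B f.
Proof.
move=> hE gE fD hgf; apply: emb_intro => //.
- by move=> x y Ax Ay E; apply: (emb_inj hE) => //; rewrite !hgf // E.
- move=> s v w wv.
  pose u i := elt (emb_dom hE (elt_dom (v i))).
  apply: (emb_inj gE); [exact: elt_dom|exact/fD/elt_dom|].
  rewrite -hgf; last exact: elt_dom.
  rewrite -(emb_fun (v := v) (w := u) hE) // -(emb_fun (v := w) (w := u) gE) //.
  by move=> i; rewrite /= wv hgf //; exact: elt_dom.
- move=> r v w wv.
  pose u i := elt (emb_dom hE (elt_dom (v i))).
  rewrite (emb_rel (v := v) (w := u) hE) // (emb_rel (v := w) (w := u) gE) //.
  by move=> i; rewrite /= wv hgf //; exact: elt_dom.
Qed.

Lemma emb_eq A B : emb A B id -> dom B `<=` dom A -> A = B.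
Proof.
move=> AB BA; have D : dom A = dom B.
  by apply/seteqP; split=> // x Ax; exact: emb_dom AB Ax.
(* The interpretations are typed over the domains, so the equality of domains is eliminated before
   they can be compared. *)
case: A B D AB {BA} => [DA [fA rA]] [DB [fB rB]] /= D;
  case: _ / D fB rB => fB rB.
set A := Structure _; set B := Structure _ => AB.
have EF : fA = fB.
  apply: functional_extensionality_dep => s; apply: funext => v; apply: val_inj.
  exact: esym (@emb_fun A B id s v v AB (fun=> erefl)).
suff ER : rA = rB by rewrite /A /B EF ER.
apply: functional_extensionality_dep => r; apply: funext => v; apply/propext.
exact: (@emb_rel A B id r v v AB (fun=> erefl)).
Qed.

Lemma iso_emb A B f : iso A B f -> emb A B f. Proof. by case. Qed.

Lemma iso_id A : iso A A id.
Proof. by split=> [|x Ax]; [exact: emb_id|exists x]. Qed.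

Lemma iso_ext A B f g :
  (forall x, dom A x -> f x = g x) -> iso A B f -> iso A B g.
Proof.
move=> fg [fE fs]; split; first exact: emb_ext fE.
by move=> y /fs[x Ax <-]; exists x => //; rewrite fg.
Qed.

Lemma iso_comp A B C f g : iso A B f -> iso B C g -> iso A C (g \o f).
Proof.
move=> [fE fs] [gE gs]; split; first exact: emb_comp fE gE.
by move=> z /gs[y /fs[x Ax <-] <-]; exists x.
Qed.

Lemma iso_inv A B f : iso A B f -> exists g, [/\ iso B A g,
  forall x, dom A x -> g (f x) = x & forall y, dom B y -> f (g y) = y].
Proof.
move=> [fE fs].
have /choice[g gP] : forall y, exists x, dom B y -> dom A x /\ f x = y.
  move=> y; have [/fs[x Ax fx]|h] := pselect (dom B y); first by exists x.
  by exists y.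
have gD y : dom B y -> dom A (g y) by move=> /gP[].
have fg y : dom B y -> f (g y) = y by move=> /gP[].
have gf x : dom A x -> g (f x) = x.
  by move=> Ax; have /gP[Ag /(emb_inj fE)] := emb_dom fE Ax; exact.
exists g; split=> //; split.
  by apply: (emb_cancel (emb_id B) fE) => // y By; rewrite fg.
by move=> x Ax; exists (f x); [exact: emb_dom fE Ax|exact: gf].
Qed.

Lemma iso_card A B f : iso A B f -> dom A #= dom B.
Proof.
move=> [fE fs]; apply: Cantor_Bernstein.
  apply: (@fun_card_le _ _ _ _ f) => [x|x y]; first exact: emb_dom fE.
  exact: emb_inj fE.
apply: (@rel_card_le _ _ _ _ (fun y x => f x = y)).
  by move=> y /fs[x Ax fx]; exists x.
by move=> y y' x _ _ <-.
Qed.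

Lemma iso_image A B f : iso A B f -> dom B = f @` dom A.
Proof.
move=> [fE fs]; apply/seteqP; split=> y; first by move=> /fs[x Ax <-]; exists x.
by move=> [x Ax <-]; exact: emb_dom fE Ax.
Qed.

Lemma iso_eq A B : iso A B id -> A = B.
Proof. by move=> [AB s]; apply: emb_eq => // y /s[x Ax <-]. Qed.

Lemma isoP A B : isomorphic A B <-> exists f, iso A B f.
Proof.
split=> [[g [gE [h gh hg]]]|[f fI]].
  pose f x := if pselect (dom A x) is left Ax then val (g (elt Ax)) else x.
  have gf a : val (g a) = f (val a).
    rewrite /f; case: pselect => [Ax|]; last by case; exact: elt_dom.
    by congr (val (g _)); apply: val_inj.
  exists f; split; first by exists g.
  move=> y By; exists (val (h (elt By))); first exact: elt_dom.
  by rewrite -gf hg.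
have [[g gE gf] fs] := fI; exists g; split=> //.
have /choice[h hP] : forall b, exists a, g a = b.
  move=> b; have [x Ax fx] := fs _ (elt_dom b); exists (elt Ax).
  by apply: val_inj; rewrite gf.
by exists h => // a; case: gE => + _ _; apply.
Qed.

Lemma iso_is_iso A B f : iso A B f ->
  exists2 g : dom A -> dom B, is_iso g & forall a, val (g a) = f (val a).
Proof.
move=> [[g gE gf] fs]; exists g => //; split=> //.
have /choice[h hP] : forall b, exists a, g a = b.
  move=> b; have [x Ax fx] := fs _ (elt_dom b); exists (elt Ax).
  by apply: val_inj; rewrite gf.
by exists h => // a; case: gE => + _ _; apply.
Qed.

Lemma copy_exists A f :
  (forall x y, dom A x -> dom A y -> f x = f y -> x = y) -> exists B, iso A B f.
Proof.
move=> fi; pose D := f @` dom A.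
have /choice[g gP] : forall y : D, exists a : dom A, f (val a) = val y.
  by move=> y; have [x Ax fx] := set_mem (valP y); exists (elt Ax).
have inD (a : dom A) : D (f (val a)) by exists (val a) => //; exact: elt_dom.
pose B := @Structure L V D (Interp
  (fun s (w : 'I_(farity s) -> D) =>
     SigSub (mem_set (inD (fint A (fun i => g (w i))))))
  (fun r (w : 'I_(rarity r) -> D) => rint A (fun i => g (w i)))).
have gE (n : nat) (v : 'I_n -> dom A) (w : 'I_n -> D) :
    (forall i, val (w i) = f (val (v i))) -> (fun i => g (w i)) = v.
  move=> wv; apply: funext => i; apply: val_inj.
  by apply: fi; [exact: elt_dom|exact: elt_dom|rewrite gP wv].
exists B; split; last by move=> y [x Ax <-]; exists x.
apply: emb_intro => //.
- by move=> x Ax; exists x.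
- by move=> s v w /gE E; rewrite /= E.
- by move=> r v w /gE E; rewrite /= E.
Qed.

(** The copy of [B] must literally contain [A'], so the points of [B] outside [A] are sent off [A'];
    this is where room in [V] is needed. *)
Lemma extend_iso (x0 : V) A A' B f : iso A A' f -> emb A B id ->
  dom B `\` dom A #<= ~` dom A' ->
  exists B' f', [/\ iso B B' f', forall x,
    dom A x -> f' x = f x & emb A' B' id].
Proof.
move=> fI AB /(card_le_fun x0)[r [rD ri]].
pose f' x := if pselect (dom A x) then f x else r x.
have f'A x : dom A x -> f' x = f x by rewrite /f'; case: pselect.
have fD x : dom A x -> dom A' (f x) by exact: emb_dom (iso_emb fI).
have [x y Bx By|B' f'I] := @copy_exists B f'.
  rewrite /f'; case: pselect => Ax; case: pselect => Ay /= E.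
  - exact: emb_inj (iso_emb fI) Ax Ay E.
  - by exfalso; apply: (rD y) => //; rewrite -E; exact: fD.
  - by exfalso; apply: (rD x) => //; rewrite E; exact: fD.
  - by apply: ri.
exists B', f'; split=> //; have [g [gI gf fg]] := iso_inv fI.
apply: emb_ext (emb_comp (emb_comp (iso_emb gI) AB) (iso_emb f'I)) => y A'y /=.
by rewrite f'A ?fg //; exact: emb_dom (iso_emb gI) A'y.
Qed.

(** * Unions of directed systems of structures *)

Section Unions.
Variables (I : Type) (F : I -> structure L V).
Hypothesis I0 : exists i : I, True.
Hypothesis Fdir :
  forall i j, exists k, emb (F i) (F k) id /\ emb (F j) (F k) id.

(** Arities are finite, so a tuple from the union already lives in one member; this makes
    interpretations on the union determined by those on the members. *)
Lemma directed_tuple n (v : 'I_n -> V) :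
  (forall i, (\bigcup_i dom (F i)) (v i)) -> exists k, forall i,
    dom (F k) (v i).
Proof.
have [i0 _] := I0.
elim: n v => [|n IH] v vU; first by exists i0; case.
have [k vk] := IH (fun i => v (widen_ord (leqnSn n) i)) (fun i => vU _).
have [j _ vj] := vU ord_max; have [l [kl jl]] := Fdir k j; exists l => i.
have [lt|ge] := ltnP i n; last first.
  have -> : i = ord_max by apply: val_inj; apply/eqP;
    rewrite eqn_leq ge -ltnS ltn_ord.
  exact: (emb_dom jl).
have -> : i = widen_ord (leqnSn n) (Ordinal lt) by apply: val_inj.
exact: (emb_dom kl).
Qed.

Lemma union_emb U C f : is_union F U -> (forall i, emb (F i) C f) -> emb U C f.
Proof.
move=> [UE FU] fE.
have lift n (v : 'I_n -> dom U) : exists k (u : 'I_n -> dom (F k)),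
    forall i, val (u i) = val (v i).
  have [|k vk] := @directed_tuple n (fun i => val (v i)).
    by move=> i; rewrite -UE; exact: elt_dom.
  by exists k, (fun i => elt (vk i)).
apply: emb_intro.
- by move=> x; rewrite UE => -[i _ /(emb_dom (fE i))].
- move=> x y; rewrite UE => -[i _ Fx] [j _ Fy].
  have [k [ik jk]] := Fdir i j.
  by apply: (emb_inj (fE k)); [exact: (emb_dom ik)|exact: (emb_dom jk)].
- move=> s v w wv; have [k [u uv]] := lift _ v.
  rewrite (emb_fun (v := u) (fE k)); last by move=> i; rewrite wv uv.
  by congr f; apply/esym/(@emb_fun _ _ id _ u v (FU k)).
- move=> r v w wv; have [k [u uv]] := lift _ v.
  rewrite -(@emb_rel _ _ id _ u v (FU k)) //.
  by rewrite (emb_rel (v := u) (w := w) (fE k)) // => i; rewrite wv uv.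
Qed.

Lemma union_iso (F' : I -> structure L V) U U' f : is_union F U ->
  is_union F' U' -> (forall i, iso (F i) (F' i) f) -> iso U U' f.
Proof.
move=> FU [U'E F'U'] fI; split.
  by apply: (union_emb FU) => i;
    exact: (@emb_comp _ _ _ f id (iso_emb (fI i)) (F'U' i)).
move=> y; rewrite U'E => -[i _ /(proj2 (fI i))[x Fx <-]]; exists x => //.
by case: FU => -> _; exists i.
Qed.

Lemma union_exists : exists U, is_union F U.
Proof.
pose D := \bigcup_i dom (F i).
have lift n (v : 'I_n -> D) : exists ku : {k : I & 'I_n -> dom (F k)},
    forall i, val (projT2 ku i) = val (v i).
  have [|k vk] := @directed_tuple n (fun i => val (v i)).
    by move=> i; exact: set_mem (valP (v i)).
  by exists (existT _ k (fun i => elt (vk i))).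
(* Each tuple is interpreted in a chosen member containing it; directedness shows that the choice
   does not matter. *)
pose l n (v : 'I_n -> D) := projT1 (cid (lift n v)).
have lP n v i : val (projT2 (l n v) i) = val (v i) by exact: (projT2 (cid (lift
  n v))).
have inD k (a : dom (F k)) : D (val a) by exists k => //; exact: elt_dom.
pose U := @Structure L V D (Interp
  (fun s (w : 'I_(farity s) -> D) =>
     SigSub (mem_set (inD _ (fint (F (projT1 (l _ w))) (projT2 (l _ w))))))
  (fun r (w : 'I_(rarity r) -> D) => rint (F (projT1 (l _ w))) (projT2 (l _
    w)))).
exists U; split=> // k; suff : emb (F k) U id by [].
apply: emb_intro => //.
- by move=> x Fx; exists k.
- move=> s v w wv /=.
  have [m [km lm]] := Fdir k (projT1 (l _ w)).
  pose u i := elt (emb_dom km (elt_dom (v i))).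
  have uw i : val (u i) = val (projT2 (l _ w) i) by rewrite lP wv.
  have := @emb_fun _ _ id _ _ u lm uw.
  by rewrite (@emb_fun _ _ id _ v u km (fun=> erefl)).
- move=> r v w wv /=.
  have [m [km lm]] := Fdir k (projT1 (l _ w)).
  pose u i := elt (emb_dom km (elt_dom (v i))).
  have uw i : val (u i) = val (projT2 (l _ w) i) by rewrite lP wv.
  rewrite (@emb_rel _ _ id _ v u km (fun=> erefl)).
  by rewrite (@emb_rel _ _ id _ _ u lm uw).
Qed.

End Unions.

Lemma glue_maps (I : Type) (D : I -> set V) (F : I -> V -> V) :
  (forall i j x, D i x -> D j x -> F i x = F j x) ->
  exists f, forall i x, D i x -> f x = F i x.
Proof.
move=> Fc; have /choice[f fP] : forall x, exists y, forall i,
  D i x -> y = F i x.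
  move=> x; have [[i Dx]|h] := pselect (exists i, D i x).
    by exists (F i x) => j Dj; exact: Fc.
  by exists x => i Di; exfalso; apply: h; exists i.
by exists f => i x; exact: fP.
Qed.

End StructureMaps.

Section UnionOn.
Variables (L : language) (V : Type) (D : wellorder).
Implicit Types (F : D -> structure L V) (J : set D) (U C : structure L V).

(** A common form for unions over a segment, over a whole order and over a subset type;
    [is_union_onE] passes between them. *)
Definition is_union_on J F U : Prop :=
  dom U = \bigcup_(j in J) dom (F j) /\ forall j, J j -> emb (F j) U id.

Definition increasing_on J F : Prop :=
  forall i j, J i -> J j -> wo_lt i j -> emb (F i) (F j) id.

Lemma is_union_onE (I : Type) (h : I -> D) J F U :
  (forall j, J j <-> exists k, h k = j) ->
  is_union (fun k => F (h k)) U <-> is_union_on J F U.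
Proof.
move=> hJ; have E : \bigcup_k dom (F (h k)) = \bigcup_(j in J) dom (F j).
  apply/seteqP; split=> x; first by move=> [k _ Fx]; exists (h k) => //;
    apply/hJ; exists k.
  by move=> [j /hJ[k <-] Fx]; exists k.
split=> -[UE FU]; split; rewrite ?UE //; first by move=> j /hJ[k <-]; exact: FU.
by move=> k; apply: FU; apply/hJ; exists k.
Qed.

Lemma is_union_seg (i : D) F U :
  is_union (fun j : seg i => F (val j)) U <-> is_union_on [set j | wo_lt j i] F
    U.
Proof.
apply: is_union_onE => j; split=> [ji|[k <-]]; last exact: seg_val_lt.
by exists (to_seg ji).
Qed.

Lemma is_union_setT F U : is_union F U <-> is_union_on setT F U.
Proof. by apply: (is_union_onE (h := id)) => j; split=> // _; exists j. Qed.

Lemma is_union_sub J F U :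
  is_union (fun j : set_type J => F (val j)) U <-> is_union_on J F U.
Proof.
apply: is_union_onE => j; split=> [Jj|[k <-]]; last exact: set_mem (valP k).
by exists (SigSub (mem_set Jj)).
Qed.

Lemma increasing_le J F i j : increasing_on J F -> J i -> J j -> wo_le i j ->
  emb (F i) (F j) id.
Proof.
move=> inc Ji Jj /wo_le_eqVlt[->|]; first exact: emb_id.
exact: inc.
Qed.

Section Increasing.
Variables (J : set D) (F : D -> structure L V).
Hypothesis J0 : J !=set0.
Hypothesis inc : increasing_on J F.

Let J0' : exists i : set_type J, True.
Proof. by have [j Jj] := J0; exists (SigSub (mem_set Jj)). Qed.

Let Fdir (i j : set_type J) : exists k : set_type J,
  emb (F (val i)) (F (val k)) id /\ emb (F (val j)) (F (val k)) id.
Proof.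
have [Ji Jj] := (set_mem (valP i), set_mem (valP j)).
have [ij|ji] := wo_total (val i) (val j).
  by exists j; split; [exact: (increasing_le inc Ji Jj ij)|exact: emb_id].
by exists i; split; [exact: emb_id|exact: (increasing_le inc Jj Ji ji)].
Qed.

Lemma union_on_emb U C f : is_union_on J F U ->
  (forall j, J j -> emb (F j) C f) -> emb U C f.
Proof.
move=> /is_union_sub FU fE; apply: (union_emb J0' Fdir FU) => i.
by apply: fE; exact: set_mem (valP i).
Qed.

Lemma union_on_exists : exists U, is_union_on J F U.
Proof. by have [U /is_union_sub FU] := union_exists J0' Fdir; exists U. Qed.

Lemma union_on_iso F' U U' f : is_union_on J F U -> is_union_on J F' U' ->
  (forall j, J j -> iso (F j) (F' j) f) -> iso U U' f.
Proof.
move=> /is_union_sub FU /is_union_sub F'U' fI.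
apply: (union_iso J0' Fdir FU F'U') => i; apply: fI; exact: set_mem (valP i).
Qed.

End Increasing.

Lemma union_on_card_le (kappa : Type) J F U : [set: nat] #<= [set: kappa] ->
  J #<= [set: kappa] -> (forall j, J j -> dom (F j) #<= [set: kappa]) ->
  is_union_on J F U -> dom U #<= [set: kappa].
Proof. by move=> kinf Jk Fk [-> _]; exact: bigcup_card_le. Qed.

End UnionOn.

(** * Universal and limit models *)

Section Class.
Variables (L : language) (V : Type) (K : structure L V -> Prop).
Variables (le : structure L V -> structure L V -> Prop).
Variables (mu kappa : Type) (W : wellorder).
Implicit Types (A B C U : structure L V) (f g h : V -> V).
Hypothesis HK : weak_AEC K le mu.
Hypothesis mukappa : [set: mu + nat] #<= [set: kappa].
Hypothesis Wsucc : is_succ_cardinal kappa W.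
Hypothesis SC : strongly_categorical K le kappa W.

Let HA := wAEC_abstract HK.

Lemma kappa_inf : [set: nat] #<= [set: kappa].
Proof.
apply: card_le_trans mukappa.
by apply: (@fun_card_le _ _ _ _ inr) => // x y _ _ [].
Qed.
Let kinf := kappa_inf.

Lemma mu_kappa : [set: mu] #<= [set: kappa].
Proof.
apply: card_le_trans mukappa.
by apply: (@fun_card_le _ _ _ _ inl) => // x y _ _ [].
Qed.

Lemma W_card_le_V : [set: W] #<= [set: V].
Proof.
have [F [_ Fc _]] := sc_categorical SC.
rewrite -(card_le_eql Fc); exact: card_leT.
Qed.

(** [V] has at least kappa^+ points because a model of that size lives in it, so removing at most
    kappa of them leaves kappa^+. *)
Lemma card_room (X Y : set V) :
  X #<= [set: kappa] -> Y #<= [set: kappa] -> Y #<= ~` X.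
Proof.
move=> Xk Yk; apply: (card_le_trans Yk).
have kW : [set: kappa] #<= [set: W] by case: Wsucc => _ [].
apply: (card_le_trans kW); apply: (succ_card_le Wsucc) => nXk.
apply: (succ_card_not_le Wsucc); apply: (card_le_trans W_card_le_V).
by rewrite -(setUv X); exact: setU_card_le.
Qed.

Lemma V_point : exists x : V, True.
Proof.
have [k _] := kappa_point kinf.
have /(card_le_trans (kappa_inf)) : [set: kappa] #<= [set: V].
  apply: card_le_trans W_card_le_V; by case: Wsucc => _ [].
exact: kappa_point.
Qed.

Definition Kkappa A : Prop := K A /\ has_card A kappa.

Lemma Kkappa_le_card A : Kkappa A -> dom A #<= [set: kappa].
Proof. by move=> [_ /card_eqPle[]]. Qed.

Lemma le_emb A B : le A B -> emb A B id.
Proof. by move=> /(Defs.le_sub HA). Qed.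

Lemma le_dom_sub A B : le A B -> dom A `<=` dom B.
Proof. by move=> /le_emb AB x Ax; exact: emb_dom AB Ax. Qed.

Lemma le_trans_class A B C : le A B -> le B C -> le A C.
Proof. exact: (Defs.le_trans HA). Qed.

Lemma le_iso_map A B A' B' f g : iso A A' f -> iso B B' g ->
  (forall x, dom A x -> f x = g x) -> le A B -> le A' B'.
Proof.
move=> fI gI fg; have [f' f'I ff] := iso_is_iso fI; have [g' g'I gg] :=
  iso_is_iso gI.
apply: (Defs.le_iso HA f'I g'I) => a b E.
by rewrite ff gg -E fg //; exact: elt_dom.
Qed.

Lemma K_iso_map A B f : iso A B f -> K A -> K B.
Proof. by move=> fI; apply: (K_iso HA); apply/isoP; exists f. Qed.

Lemma Kkappa_iso A B f : iso A B f -> Kkappa A -> Kkappa B.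
Proof.
move=> fI [KA cA]; split; first exact: K_iso_map fI KA.
by rewrite /has_card (card_eql (card_esym (iso_card fI))).
Qed.

Lemma Kkappa_intro A : K A -> (exists2 B, Kkappa B & dom B `<=` dom A) ->
  dom A #<= [set: kappa] -> Kkappa A.
Proof.
move=> KA [B [_ /card_eqPle[_ kB]] BA] Ak; split=> //;
  apply: Cantor_Bernstein => //.
exact: card_le_trans kB (subset_card_le BA).
Qed.

(** The total-map counterpart of [strong_embedding], with the strong image given as a structure of
    its own; in this form the maps compose. *)
Definition strong A B f : Prop := exists2 A', iso A A' f & le A' B.

Lemma strong_emb A B f : strong A B f -> emb A B f.
Proof. by move=> [A' fI /le_emb];
  exact: (@emb_comp _ _ _ _ _ f id (iso_emb fI)). Qed.

Lemma strong_le A B : le A B -> strong A B id.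
Proof. by exists A => //; exact: iso_id. Qed.

Lemma strong_comp A B C f g : strong A B f -> strong B C g -> strong A C (g \o
  f).
Proof.
move=> [A' fI A'B] [B' gI B'C].
have [x y Ax Ay|A'' gI'] := @copy_exists _ _ A' g.
  by apply: (emb_inj (iso_emb gI)); exact: (le_dom_sub A'B).
exists A''; first exact: iso_comp fI gI'.
by apply: le_trans_class B'C; exact: le_iso_map gI' gI _ A'B.
Qed.

Lemma strong_le_comp A B C f : strong A B f -> le B C -> strong A C f.
Proof. by move=> fS /strong_le; exact: strong_comp. Qed.

Lemma fun_total A B (g : dom A -> dom B) : exists f, forall a,
  val (g a) = f (val a).
Proof.
exists (fun x => if pselect (dom A x) is left Ax then val (g (elt Ax)) else x)
  => a.
case: pselect => [Ax|]; last by case; exact: elt_dom.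
by congr (val (g _)); apply: val_inj.
Qed.

Lemma strong_embedding_strong A B (g : dom A -> dom B) f :
  strong_embedding le g -> (forall a, val (g a) = f (val a)) -> strong A B f.
Proof.
move=> [gE [A' A'E A'B]] gf; exists A' => //.
have fE : emb A B f by exists g.
split.
  apply: (emb_cancel fE (le_emb A'B)) => // x Ax; rewrite A'E.
  by exists (elt Ax); rewrite ?gf.
move=> y; rewrite A'E => -[a _ <-]; exists (val a); first exact: elt_dom.
by rewrite gf.
Qed.

Lemma strong_strong_embedding A B f : strong A B f ->
  exists2 g : dom A -> dom B, strong_embedding le g & forall a,
    val (g a) = f (val a).
Proof.
move=> fS; have [g gE gf] := strong_emb fS; exists g => //; split=> //.
case: fS => A' fI A'B; exists A' => //; rewrite (iso_image fI).
apply/seteqP; split=> y.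
  by move=> [x Ax <-]; exists (elt Ax); rewrite ?gf.
by move=> [a _ <-]; exists (val a); [exact: elt_dom|rewrite gf].
Qed.

(* Universality transported along isomorphisms, so that it can be composed. *)
Definition univ A B : Prop :=
  forall A' C f, iso A' A f -> le A' C -> Kkappa C ->
  exists2 f', forall x, dom A' x -> f' x = f x & strong C B f'.

(** [C] extends only a copy of [A], so it is first moved to an extension of [A] itself; the literal
    universality of [B] then applies, both models having size kappa. *)
Lemma universal_over_univ A B : Kkappa A -> universal_over K le A B -> univ A B.
Proof.
move=> KA [_ _ AB] A' C f fI A'C KC; have [x0 _] := V_point.
have [|C' [f1 [f1I f1f AC']]] := extend_iso x0 fI (le_emb A'C).
  apply: card_room; first exact: Kkappa_le_card.
  apply: card_le_trans (Kkappa_le_card KC); apply: subset_card_le => x; by case.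
have leAC' : le A C' by apply: le_iso_map fI f1I _ A'C => x /f1f.
have KC' := Kkappa_iso f1I KC.
have [|g gS gA] := AB C' (proj1 KC') leAC'.
  by rewrite (card_eql (proj2 KC')); apply: card_esym; case: KA.
have [f2 f2g] := fun_total g.
have f2S := strong_embedding_strong gS f2g.
exists (f2 \o f1); last first.
  apply: strong_comp f2S; exists C'; first exact: f1I.
   exact: (Defs.le_refl HA (proj1 KC')).
move=> x A'x /=; rewrite f1f //.
have Afx : dom A (f x) by exact: emb_dom (iso_emb fI) A'x.
have C'fx := le_dom_sub leAC' Afx.
by have := f2g (elt C'fx); rewrite gA // => <-.
Qed.

Lemma univ_universal_over A B : Kkappa A -> Kkappa B -> univ A B ->
  universal_over K le A B.
Proof.
move=> [KA cA] [KB _] AB; split=> // C KC AC cC.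
have [|f fA fS] := AB A C id (iso_id A) AC.
  by split=> //; rewrite /has_card (card_eql cC).
have [g gS gf] := strong_strong_embedding fS; exists g => // b Ab.
by rewrite gf fA.
Qed.

(** Universality is applied to the trivial extension of [A] by itself: the resulting map is the
    identity on [A], so its strong image is [A]. *)
Lemma univ_le A B : Kkappa A -> univ A B -> le A B.
Proof.
move=> KA AB; have [f fA [A' fI A'B]] :=
  AB A A id (iso_id A) (Defs.le_refl HA (proj1 KA)) KA.
suff -> : A = A' by [].
by apply/iso_eq/(iso_ext _ fI).
Qed.

Lemma univ_exists A : Kkappa A -> exists2 B, Kkappa B & univ A B.
Proof.
move=> KA; have [B [cB AB]] := sc_universal SC (proj1 KA) (proj2 KA).
by exists B; [split=> //; case: AB|exact: universal_over_univ].
Qed.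

Lemma univ_le_r A B C : univ A B -> le B C -> univ A C.
Proof.
move=> AB BC A' D f fI A'D KD; have [f' f'f f'S] := AB _ _ _ fI A'D KD.
by exists f' => //; exact: strong_le_comp f'S BC.
Qed.

(** Here amalgamation is obtained. Some [D] universal over [A] receives [C] and [A'] over [A];
    viewed as an extension of its copy of [A'], it is absorbed by [B], and [C] goes along. *)
Lemma univ_le_l A A' B : Kkappa A -> Kkappa A' -> le A A' -> univ A' B -> univ A
  B.
Proof.
move=> KA KA' AA' A'B A0 C f fI A0C KC.
have [D KD AD] := univ_exists KA.
have [u uf uS] := AD A0 C f fI A0C KC.
have [w wA [D' wI D'D]] := AD A A' id (iso_id A) AA' KA'.
have [w' [w'I w'w ww']] := iso_inv wI.
have [z zw' zS] := A'B D' D w' w'I D'D KD.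
exists (z \o u); last exact: strong_comp uS zS.
move=> x A0x /=; have Afx := emb_dom (iso_emb fI) A0x.
have A'fx := le_dom_sub AA' Afx.
rewrite uf // -{1}(wA _ Afx) zw' ?w'w //; exact: emb_dom (iso_emb wI) A'fx.
Qed.

Lemma univ_iso A B A' B' f : iso A A' f -> iso B B' f -> (dom A `<=` dom B) ->
  univ A B -> univ A' B'.
Proof.
move=> fI fI' sAB AB A0 C g gI A0C KC; have [h [hI hf fh]] := iso_inv fI.
have [k kE kS] := AB A0 C (h \o g) (iso_comp gI hI) A0C KC.
exists (f \o k) => [x A0x|] /=.
  by rewrite kE //= fh //; exact: emb_dom (iso_emb gI) A0x.
case: kS => C' kI C'B.
have [x y Cx Cy|C'' fI''] := @copy_exists _ _ C' f.
  by apply: (emb_inj (iso_emb fI')); exact: le_dom_sub C'B _ _.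
by exists C''; [exact: iso_comp kI fI''|exact: le_iso_map fI'' fI' _ C'B].
Qed.

(** Otherwise a proper extension [C] of [A] would map over [A] into [A]. For [x] in [C] the points
    [x] and [f x] then have the same image, so [x] is in [A]. *)
Lemma univ_proper A B : Kkappa A -> univ A B -> ~ (dom B `<=` dom A).
Proof.
move=> KA AB BA; have [C [KC cC CA AC]] :=
  sc_extension SC (proj1 KA) (proj2 KA).
have [f fA fS] := AB A C id (iso_id A) AC (conj KC cC).
apply: CA; apply/esym/(emb_eq (le_emb AC)) => x Cx.
have Bf : dom B (f x) by exact: emb_dom (strong_emb fS) Cx.
have /BA Af := Bf; have := fA _ Af => E.
by rewrite -(emb_inj (strong_emb fS) (le_dom_sub AC Af) Cx E).
Qed.

(** The union axiom is applied to the order induced on [J]. Continuity is therefore asked at the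
    limits of [J] as an order of its own, which need not be suprema of [J] in [D]. *)
Lemma chain_union (D : wellorder) (J : set D) (F : D -> structure L V) U :
  J !=set0 -> (forall i, J i -> exists2 j, J j & wo_lt i j) ->
  (forall i, J i -> K (F i)) ->
  (forall i j, J i -> J j -> wo_lt i j -> le (F i) (F j)) ->
  (forall i, J i -> (exists2 j, J j & wo_lt j i) ->
    (forall j, J j -> wo_lt j i -> exists2 k, J k & wo_lt j k /\ wo_lt k i) ->
    dom (F i) `<=` \bigcup_(j in [set j | J j /\ wo_lt j i]) dom (F j)) ->
  is_union_on J F U -> K U /\ forall i, J i -> le (F i) U.
Proof.
move=> [j0 Jj0] Jnomax FK Fle Fcont /is_union_sub FU.
have Jv (i : suborder J) : J (val i) by exact: set_mem (valP i).
have [||KU leU] := wAEC_union HK (D := suborder J) _ _ FU; last first.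
- by split=> // i Ji; exact: (leU (SigSub (mem_set Ji))).
- split.
  + by move=> i; exact: FK.
  + by move=> i j /suborder_lt; exact: Fle.
  + move=> i [[[j0' j0i]] li];
      apply/(@is_union_seg _ _ (suborder J) i (fun u => F (val u))); split;
      last first.
      by move=> j /suborder_lt ji; apply: le_emb; exact: Fle.
    apply/seteqP; split=> x; last first.
      by move=> [j /suborder_lt ji]; apply: le_dom_sub; exact: Fle.
    move=> Fix; have [||j [Jj ji] Fx] := Fcont _ (Jv i) _ _ x Fix.
    * by exists (val j0'); [exact: Jv|apply/suborder_lt; exact: set_mem j0i].
    * move=> j Jj ji; pose j' : suborder J := SigSub (mem_set Jj).
      have ji' : wo_lt j' i by apply/suborder_lt.
      have [[k ki] /seg_lt jk] := li (to_seg ji').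
      exists (val k); first exact: Jv.
      split; first exact: (proj1 (@suborder_lt _ J j' k) jk).
      exact: (proj1 (@suborder_lt _ J k i) (set_mem ki)).
    * by exists (SigSub (mem_set Jj)) => //; apply/suborder_lt.
- split; first by constructor; exact: (SigSub (mem_set Jj0)).
  move=> i; have [j Jj ij] := Jnomax _ (Jv i).
  by exists (SigSub (mem_set Jj)); apply/suborder_lt.
Qed.

(** Only one inclusion of continuity is recorded; the other follows from [uc_le]. *)
Record uchain (D : wellorder) A (N : D -> structure L V) : Prop := UChain {
  uc_Kkappa : forall i, Kkappa (N i);
  uc_zero : forall i, is_zero i -> N i = A;
  uc_le : forall i j, wo_lt i j -> le (N i) (N j);
  uc_cont : forall i, is_limit i ->
    dom (N i) `<=` \bigcup_(j in [set j | wo_lt j i]) dom (N j);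
  uc_univ : forall i j, is_succ i j -> univ (N i) (N j) }.

Lemma le_increasing_on (D : wellorder) (J : set D) (F : D -> structure L V) :
  (forall i j, J i -> J j -> wo_lt i j -> le (F i) (F j)) -> increasing_on J F.
Proof. by move=> Fle i j Ji Jj ij; apply: le_emb; exact: Fle. Qed.

Lemma limit_chain_union (D : wellorder) (i : D) (F : D -> structure L V) U :
  is_limit i -> (forall j, wo_lt j i -> K (F j)) ->
  (forall j k, wo_lt j k -> wo_lt k i -> le (F j) (F k)) ->
  (forall j, wo_lt j i -> is_limit j ->
    dom (F j) `<=` \bigcup_(k in [set k | wo_lt k j]) dom (F k)) ->
  is_union_on [set j | wo_lt j i] F U -> K U /\ forall j,
    wo_lt j i -> le (F j) U.
Proof.
move=> [j0i li] FK Fle Fcont; apply: chain_union => //.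
- by move=> j /li[k jk ki]; exists k.
- by move=> j k _ ki jk; exact: Fle.
- move=> j ji [k _ kj] lj x Fx; have [|l lj' Fl] := Fcont j ji _ x Fx.
    split; first by exists k.
    move=> l lj'; have [m _ [lm mj]] := lj l (wo_lt_trans lj' ji) lj'.
    by exists m.
  by exists l => //; split=> //; exact: wo_lt_trans lj' ji.
Qed.

(** The bound on proper segments keeps limit stages of size kappa. It holds for [delta] and for
    kappa^+ itself, and both lengths are used. *)
Lemma uchain_exists (D : wellorder) A :
  (forall i : D, [set j | wo_lt j i] #<= [set: kappa]) -> Kkappa A ->
  exists N : D -> structure L V, uchain A N.
Proof.
move=> Dk KA.
pose P (i : D) (g : D -> structure L V) B := [/\ Kkappa B, is_zero i -> B = A,
  forall j, wo_lt j i -> le (g j) B,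
  is_limit i -> dom B `<=` \bigcup_(j in [set j | wo_lt j i]) dom (g j)
  & forall j, is_succ j i -> univ (g j) B].
have [||N NP] := @wo_recursion D _ A P; last first.
- exists N; split.
  + by move=> i; case: (NP i).
  + by move=> i; case: (NP i).
  + by move=> j i; case: (NP i) => _ _ + _ _; exact.
  + by move=> i; case: (NP i).
  + by move=> j i; case: (NP i) => _ _ _ _; exact.
- move=> i g IH; have [zi|[j ji]|li] := zero_succ_limit i.
  + exists A; split=> //.
    * by move=> j /zi.
    * by move=> /limit_not_zero.
    * by move=> j /succ_not_zero.
  + have [Kgj _ gle _ _] := IH j (proj1 ji).
    have [B KB jB] := univ_exists Kgj; exists B; split=> //.
    * by move=> /(succ_not_zero ji).
    * move=> k /(succ_le ji)/wo_le_eqVlt[->|/gle kj]; first exact: univ_le.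
      apply: le_trans_class kj _; exact: univ_le.
    * by move=> /(succ_not_limit ji).
    * by move=> k /(succ_inj ji) <-.
  + have gle j k : wo_lt j k -> wo_lt k i -> le (g j) (g k).
      by move=> jk /IH[_ _ + _ _]; exact.
    have [||U gU] := @union_on_exists _ _ D [set j | wo_lt j i] g.
    * by case: li.
    * by apply: le_increasing_on => j k _ ki jk; exact: gle.
    have [|||KU leU] := limit_chain_union li _ _ _ gU.
    * by move=> j /IH[[]].
    * exact: gle.
    * by move=> j /IH[].
    exists U; split=> //.
    * apply: Kkappa_intro => //.
        have [[j ji] _] := li; exists (g j); first by case: (IH j ji).
        exact: le_dom_sub (leU j ji).
      by apply: union_on_card_le gU => // j /IH[/Kkappa_le_card].
    * by move=> /(limit_not_zero li).
    * by move=> _ x; case: gU => ->.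
    * by move=> j /succ_not_limit.
- move=> i g g' B gg' [KB zB leB cB uB]; split=> //.
  + by move=> j ji; rewrite -gg' //; exact: leB.
  + by move=> li x /(cB li)[j ji gx]; exists j => //; rewrite -gg'.
  + by move=> j ji; rewrite -gg'; [exact: uB|case: ji].
Qed.

Lemma uchain_union (D : wellorder) A (N : D -> structure L V) B :
  is_limit_ordinal D -> uchain A N -> is_union N B ->
  K B /\ forall i, le (N i) B.
Proof.
move=> [[i0] Dl] UN /is_union_setT NB.
have [|||||KB leB] := chain_union _ _ _ _ _ NB.
- by exists i0.
- by move=> i _; have [j ij] := Dl i; exists j.
- by move=> i _; case: (uc_Kkappa UN i).
- by move=> i j _ _; exact: (uc_le UN).
- move=> i _ [j _ ji] li x Nx; have [|k ki Nk] := uc_cont UN _ Nx.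
    by split; [exists j|move=> k ki; have [l _ [kl li']] := li k I ki;
      exists l].
  by exists k.
- by split=> // i; exact: leB.
Qed.

Lemma uchain_le_dom (D : wellorder) A (N : D -> structure L V) i j :
  uchain A N -> wo_le i j -> dom (N i) `<=` dom (N j).
Proof.
by move=> UN /wo_le_eqVlt[->//|/(uc_le UN)/le_dom_sub].
Qed.

(** * Limit models: existence, change of base, uniqueness *)

Variable delta : wellorder.
Hypothesis dlim : is_limit_ordinal delta.
Hypothesis dW : ord_lt delta W.

Lemma delta_card_le (X : set delta) : X #<= [set: kappa].
Proof.
apply: (card_le_trans (card_leT X)); case: dW => a [f [g fg _] _].
apply: card_le_trans (seg_card_le Wsucc a).
apply: (@fun_card_le _ _ _ _ (fun i => val (f i))) => [i _|i j _ _ /val_inj].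
  exact: seg_val_lt.
exact: (can_inj fg).
Qed.

Definition limit_model A B : Prop :=
  exists2 N : delta -> structure L V, uchain A N & is_union N B.

Lemma limit_overE A B : limit_over K le kappa delta A B <-> limit_model A B.
Proof.
split=> [[N [[NK Nle Nc] cN N0 NB Nu]]|[N UN NB]]; exists N => //.
  have KN i : Kkappa (N i) by split.
  split=> // [i /is_limitE/Nc/is_union_seg[-> _] //|i j ij].
  exact: universal_over_univ (KN i) (Nu _ _ ij).
split=> //.
- split.
  + by move=> i; case: (uc_Kkappa UN i).
  + exact: uc_le UN.
  + move=> i /is_limitE li; apply/is_union_seg; split.
      apply/seteqP; split; first exact: uc_cont UN _ li.
      by move=> x [j ji Nx]; exact: le_dom_sub (uc_le UN ji) _ Nx.
    by move=> j ji; apply: le_emb; exact: uc_le UN _ _ ji.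
- by move=> i; case: (uc_Kkappa UN i).
- exact: uc_zero UN.
- by move=> i j ij; apply: univ_universal_over (uc_univ UN ij);
    exact: uc_Kkappa UN _.
Qed.

Let d0 : exists z : delta, is_zero z.
Proof. by case: dlim => -[i] _; exact: (exists_zero i). Qed.

Lemma limit_model_Kkappa A B : limit_model A B -> [/\ Kkappa A,
  Kkappa B & le A B].
Proof.
move=> [N UN NB]; have [z zz] := d0; have [KB leB] := uchain_union dlim UN NB.
have KA : Kkappa A by rewrite -(uc_zero UN zz); exact: uc_Kkappa UN _.
have AB : le A B by rewrite -(uc_zero UN zz).
split=> //; apply: Kkappa_intro => //; first by exists A => //;
  exact: le_dom_sub.
move/is_union_setT: NB; apply: union_on_card_le => //;
  first exact: delta_card_le.
by move=> i _; apply: Kkappa_le_card; exact: uc_Kkappa UN _.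
Qed.

Lemma limit_model_exists A : Kkappa A -> exists B, limit_model A B.
Proof.
move=> KA; have [|N UN] := @uchain_exists delta A _ KA.
  by move=> i; exact: delta_card_le.
have [||B /is_union_setT NB] := @union_on_exists _ _ delta setT N.
- by have [z _] := d0; exists z.
- by apply: le_increasing_on => i j _ _; exact: uc_le UN _ _.
by exists B, N.
Qed.

Lemma limit_model_univ A B : limit_model A B -> univ A B.
Proof.
move=> [N UN NB]; have [z zz] := d0; have [_ leB] := uchain_union dlim UN NB.
have [z' zz'] := limit_ordinal_is_limit dlim z.
by apply: univ_le_r (leB z'); rewrite -(uc_zero UN zz);
  exact: uc_univ UN _ _ zz'.
Qed.

(** Only the first term of the chain is replaced, by the smaller [A]; its next term stays universal
    over it by [univ_le_l]. *)
Lemma limit_model_le_l A A' B :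
  Kkappa A -> le A A' -> limit_model A' B -> limit_model A B.
Proof.
move=> KA AA' [N UN NB].
have [z zz] := d0; have N0 := uc_zero UN zz.
have KA' : Kkappa A' by rewrite -N0; exact: uc_Kkappa UN _.
pose N' i := if pselect (is_zero i) then A else N i.
have N'z i : is_zero i -> N' i = A by rewrite /N'; case: pselect.
have N'n i : ~ is_zero i -> N' i = N i by rewrite /N'; case: pselect.
have nz i j : wo_lt i j -> ~ is_zero j by move=> ij /(_ i).
have AN i : le A (N i).
  apply: (le_trans_class AA'); rewrite -N0.
  have [<-|/(uc_le UN)//] := wo_le_eqVlt (zero_le i zz).
  by rewrite N0; exact: (Defs.le_refl HA (proj1 KA')).
have N'N i : le (N' i) (N i).
  have [zi|nzi] := pselect (is_zero i); first by rewrite N'z.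
  by rewrite N'n //; exact: (Defs.le_refl HA (proj1 (uc_Kkappa UN i))).
have KN' i : Kkappa (N' i).
  by rewrite /N'; case: pselect => h; [exact: KA|exact: uc_Kkappa UN _].
exists N'.
  split=> //.
  - move=> i j ij; rewrite [N' j]N'n; last exact: nz ij.
    by apply: le_trans_class (N'N i) _; exact: uc_le UN _ _ ij.
  - move=> i li; rewrite N'n; last exact: limit_not_zero.
    move=> x /(uc_cont UN li)[j ji Nx].
    (* [j] may be the index whose model was shrunk to [A]; its successor [k] is not, and is still
       below the limit. *)
    have [k jk ki] := limit_succ li ji; exists k => //.
    rewrite N'n; last exact: nz (proj1 jk).
    exact: le_dom_sub (uc_le UN (proj1 jk)) _ Nx.
  - move=> i j ij; rewrite [N' j]N'n; last exact: nz (proj1 ij).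
    apply: univ_le_l (uc_univ UN ij) => //; exact: uc_Kkappa UN _.
have [KB leB] := uchain_union dlim UN NB; split; last first.
  by move=> i; apply: le_emb; exact: le_trans_class (N'N i) (leB i).
case: NB => -> _; apply/seteqP; split=> x [i _ Nx]; last first.
  by exists i => //; exact: le_dom_sub (N'N i) _ Nx.
have [j ij] := limit_ordinal_is_limit dlim i; exists j => //.
rewrite N'n; last exact: nz (proj1 ij).
exact: le_dom_sub (uc_le UN (proj1 ij)) _ Nx.
Qed.

Lemma limit_model_iso A B A' B' f :
  iso A A' f -> iso B B' f -> limit_model A B -> limit_model A' B'.
Proof.
move=> fA fB [N UN NB]; have [_ leB] := uchain_union dlim UN NB.
have /choice[N' N'I] : forall i, exists X, iso (N i) X f.
  move=> i; apply: copy_exists => x y Nx Ny.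
  by apply: (emb_inj (iso_emb fB)); exact: le_dom_sub (leB i) _ _.
exists N'.
  split.
  - by move=> i; exact: Kkappa_iso (N'I i) (uc_Kkappa UN i).
  - move=> i zi; apply: iso_eq; have := N'I i; rewrite (uc_zero UN zi) => AN'.
    have [g [gI gf fg]] := iso_inv AN'.
    by apply: (iso_ext _ (iso_comp gI fA)) => x /fg.
  - by move=> i j ij; exact: le_iso_map (N'I i) (N'I j) _ (uc_le UN ij).
  - move=> i li y; rewrite (iso_image (N'I i)) => -[x /(uc_cont UN li)[j ji Nx]
      <-].
    by exists j => //; exact: emb_dom (iso_emb (N'I j)) Nx.
  - move=> i j ij; apply: univ_iso (N'I i) (N'I j) _ (uc_univ UN ij).
    exact: le_dom_sub (uc_le UN (proj1 ij)).
split; last first.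
  by move=> i; apply: le_emb; exact: le_iso_map (N'I i) fB _ (leB i).
rewrite (iso_image fB); case: NB => -> _; apply/seteqP; split=> y.
  by move=> [x [i _ Nx] <-]; exists i => //;
    exact: emb_dom (iso_emb (N'I i)) Nx.
move=> [i _]; rewrite (iso_image (N'I i)) => -[x Nx <-].
by exists x => //; exists i.
Qed.

(** Half a turn of the back and forth: [D] extends the copy [C] of [A], so [B] absorbs it by a map
    that undoes [h]. *)
Lemma strong_extend A B C D h : univ A B -> iso A C h -> le C D -> Kkappa D ->
  strong A D h -> exists2 k, strong D B k & forall x, dom A x -> k (h x) = x.
Proof.
move=> AB hI CD KD hS; have [g [gI gh hg]] := iso_inv hI.
have [k kg kS] := AB C D g gI CD KD; exists k => // x Ax.
by rewrite kg ?gh //; exact: emb_dom (iso_emb hI) Ax.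
Qed.

(* Back and forth: [h i] embeds [N i] in [N' (s i)] with range containing
   [N' i], so that at limits it is onto. *)
Lemma limit_model_unique A B A' B' f :
  iso A A' f -> limit_model A B -> limit_model A' B' ->
  exists2 f', forall x, dom A x -> f' x = f x & iso B B' f'.
Proof.
move=> fI [N UN NB] [N' UN' NB'].
have [z zz] := d0.
have /choice[s sP] : forall i : delta, exists j, is_succ i j.
  exact: limit_ordinal_is_limit.
pose P i (F : delta -> V -> V) (h : V -> V) := [/\ strong (N i) (N' (s i)) h,
  forall y, dom (N' i) y -> exists2 x, dom (N i) x & h x = y,
  is_zero i -> forall x, dom A x -> h x = f x
  & forall j, wo_lt j i -> forall x, dom (N j) x -> h x = F j x].
have Nle i j : wo_le i j -> dom (N i) `<=` dom (N j) by exact: uchain_le_dom UN.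
have N'le i j : wo_le i j -> dom (N' i) `<=` dom (N' j) by exact: uchain_le_dom
  UN'.
have [||F FP] := @wo_recursion delta _ id P.
- move=> i F F' h FF' [hS hr h0 hF]; split=> // j ji x Nx.
  by rewrite -FF' //; exact: hF.
- move=> i F IH; have [zi|[j ji]|li] := zero_succ_limit i.
  + exists f; split.
    * exists A'; first by rewrite (uc_zero UN zi).
      by rewrite -(uc_zero UN' zi); exact: uc_le UN' _ _ (proj1 (sP i)).
    * by move=> y; rewrite (uc_zero UN' zi) (uc_zero UN zi) => /(proj2 fI).
    * by [].
    * by move=> j /zi.
  + have [FjS Fjr Fj0 FjF] := IH j (proj1 ji).
    have sj : s j = i.
      have [lt1 _] := sP j; apply: wo_anti;
        first exact: succ_lt (sP j) (proj1 ji).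
      exact: succ_lt ji lt1.
    rewrite sj in FjS; have [X' FjI X'N'] := FjS.
    (* Forth and back in one step: [h'] sends [N' i] into [N i] and inverts [F j]; then [h] sends
       [N i] into [N' (s i)] and inverts [h']. Hence [h] extends [F j] and its range contains
       [N' i]. *)
    have [h' h'S h'K] := strong_extend (uc_univ UN ji) FjI X'N' (uc_Kkappa UN'
      i) FjS.
    have [Y h'I YN] := h'S.
    have [h hS hK] := strong_extend (uc_univ UN' (sP i)) h'I YN (uc_Kkappa UN i)
      h'S.
    have hF x : dom (N j) x -> h x = F j x.
      move=> Nx; rewrite -{1}(h'K x Nx) hK //.
      by exact: (emb_dom (strong_emb FjS)).
    exists h; split=> //.
    * move=> y N'y; exists (h' y); last exact: hK.
      exact: emb_dom (strong_emb h'S) N'y.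
    * by move=> /(succ_not_zero ji).
    * move=> k /(succ_le ji) kj x Nx; rewrite hF; last exact: Nle kj _ Nx.
      have [E|kj'] := wo_le_eqVlt kj; first by rewrite E.
      exact: FjF.
  + have Fc j k : wo_lt k i -> wo_le j k -> forall x,
      dom (N j) x -> F k x = F j x.
      move=> ki /wo_le_eqVlt[-> //|jk] x Nx.
      by have [_ _ _] := IH k ki; apply.
    have [j k x|h hF] := @glue_maps V delta
        (fun j => [set x | wo_lt j i /\ dom (N j) x]) F.
      move=> [ji Nj] [ki Nk]; have [jk|kj] := wo_total j k.
        by rewrite (Fc j k).
      by rewrite (Fc k j).
    have NU : is_union_on [set j | wo_lt j i] N (N i).
      split; last by move=> j ji; exact: le_emb (uc_le UN ji).
      apply/seteqP; split; first exact: uc_cont UN _ li.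
      by move=> x [j ji]; apply: Nle; exact: wo_ltW.
    have hI : iso (N i) (N' i) h.
      split.
        apply: (union_on_emb _ _ NU); first by case: li.
          by apply: le_increasing_on => j k _ _; exact: (uc_le UN).
        move=> j ji; have [FjS _ _ _] := IH j ji.
        apply: (@emb_ext _ _ _ _ (F j)) => [x Nx|]; first by rewrite (hF j).
        have [l jl li'] := limit_succ li ji.
        apply: strong_emb; apply: strong_le_comp FjS _.
        have -> : s j = l.
          apply: wo_anti; first exact: succ_lt (sP j) (proj1 jl).
          exact: succ_lt jl (proj1 (sP j)).
        exact: uc_le UN' _ _ li'.
      move=> y /(uc_cont UN' li)[j ji N'y]; have [_ Fr _ _] := IH j ji.
      have [x Nx <-] := Fr y N'y; exists x; first by apply: Nle Nx;
        exact: wo_ltW.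
      by rewrite (hF j).
    exists h; split.
    * by exists (N' i) => //; exact: uc_le UN' _ _ (proj1 (sP i)).
    * by case: hI.
    * by move=> /(limit_not_zero li).
    * by move=> j ji x Nx; rewrite (hF j).
have Fc j k : wo_le j k -> forall x, dom (N j) x -> F k x = F j x.
  move=> /wo_le_eqVlt[-> //|jk] x Nx.
  by have [_ _ _] := FP k; apply.
have [j k x Nj Nk|h hF] := @glue_maps V delta (fun j => dom (N j)) F.
  by have [jk|kj] := wo_total j k; [rewrite (Fc j k)|rewrite (Fc k j)].
exists h.
  have [_ _ F0 _] := FP z.
  by move=> x Ax; rewrite (hF z) ?F0 //; rewrite (uc_zero UN zz).
have [_ leB'] := uchain_union dlim UN' NB'.
split.
  move/is_union_setT: (NB) => NB0; apply: (union_on_emb _ _ NB0);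
    first by exists z.
    by apply: le_increasing_on => j k _ _; exact: (uc_le UN).
  move=> j _; have [FjS _ _ _] := FP j.
  apply: (@emb_ext _ _ _ _ (F j)) => [x Nx|]; first by rewrite (hF j).
  by apply: strong_emb; exact: strong_le_comp FjS (leB' _).
case: NB NB' => NBd _ [-> _] y [j _ N'y]; have [_ Fr _ _] := FP j.
have [x Nx <-] := Fr y N'y; exists x; first by rewrite NBd; exists j.
by rewrite (hF j).
Qed.

(** * Back and forth *)

(** The pieces are merely substructures of [M], and strength is measured inside [G]. The notion thus
    makes sense for a union that is not in K. *)
Definition rich (M : structure L V) (G : set (structure L V)) : Prop :=
  [/\ forall X, G X -> Kkappa X /\ emb X M id,
      forall X (Y : set V), G X -> Y `<=` dom M -> Y #<= [set: kappa] ->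
        exists X', [/\ G X', le X X' & Y `<=` dom X']
    & forall X, G X -> exists2 X', G X' & univ X X'].

(** The two sides need not be pieces, only strong in one: universality places the image of a piece
    strongly inside another piece, not onto it. *)
Definition partial_iso (G G' : set (structure L V)) A A' f : Prop :=
  [/\ Kkappa A, iso A A' f, exists2 X, G X & le A X & exists2 X',
    G' X' & le A' X'].

Lemma partial_iso_inv G G' A A' f : partial_iso G G' A A' f ->
  exists2 g, partial_iso G' G A' A g & forall x, dom A x -> g (f x) = x.
Proof.
move=> [KA fI AX A'X']; have [g [gI gf fg]] := iso_inv fI.
by exists g => //; split=> //; exact: Kkappa_iso fI KA.
Qed.

(** A piece [B] above [X] catches [Z]. On the other side a piece universal over [X'] is universal
    over the smaller [A'] too, hence absorbs [B]. *)
Lemma partial_iso_extend M M' G G' A A' f (Z : set V) :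
  rich M G -> rich M' G' -> partial_iso G G' A A' f ->
  Z `<=` dom M -> Z #<= [set: kappa] ->
  exists B B' g, [/\ partial_iso G G' B B' g, dom A `<=` dom B,
    Z `<=` dom B & forall x, dom A x -> g x = f x].
Proof.
move=> [GK Gc _] [G'K _ G'u] [KA fI [X GX AX] [X' GX' A'X']] ZM Zk.
have [B [GB XB ZB]] := Gc X Z GX ZM Zk.
have [Y' GY' X'Y'] := G'u X' GX'; have AB := le_trans_class AX XB.
have KA' := Kkappa_iso fI KA.
have [KX' _] := G'K X' GX'; have [KB _] := GK B GB.
have [g gf [B' gI B'Y']] := univ_le_l KA' KX' A'X' X'Y' fI AB KB.
exists B, B', g; split=> //; last exact: le_dom_sub.
split=> //; first by exists B => //; exact: (Defs.le_refl HA (proj1 KB)).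
by exists Y'.
Qed.

Lemma partial_iso_emb M M' G G' A A' f : rich M G -> rich M' G' ->
  partial_iso G G' A A' f -> emb A M id /\ emb A M' f.
Proof.
move=> [GK _ _] [G'K _ _] [_ fI [B GB AB] [B' GB' A'B']]; split.
  exact: (@emb_comp _ _ _ _ _ id id (le_emb AB) (proj2 (GK _ GB))).
apply: (@emb_comp _ _ _ _ _ f id (iso_emb fI)).
exact: (@emb_comp _ _ _ _ _ id id (le_emb A'B') (proj2 (G'K _ GB'))).
Qed.

(** * Preservation of infinitary formulas *)

Definition linked (M M' : structure L V) (G G' : set (structure L V)) (X : Type)
    (v : X -> dom M) (v' : X -> dom M') : Prop :=
  exists A A' f, partial_iso G G' A A' f /\
    forall x, dom A (val (v x)) /\ val (v' x) = f (val (v x)).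

Lemma linked_eval M M' (X : Type) A f (v : X -> dom M) (v' : X -> dom M') t :
  emb A M id -> emb A M' f ->
  (forall x, dom A (val (v x)) /\ val (v' x) = f (val (v x))) ->
  dom A (val (eval (str M) v t)) /\
  val (eval (str M') v' t) = f (val (eval (str M) v t)).
Proof.
move=> AM AM' vv'; elim: t => [x|s u IH] /=; first exact: vv'.
pose w i := elt (proj1 (IH i)).
have wE i : val (eval (str M) v (u i)) = id (val (w i)) by [].
have -> := @emb_fun _ _ _ _ _ _ w _ AM wE.
split; first exact: elt_dom.
apply: (@emb_fun _ _ _ _ _ _ w _ AM') => i; exact: (proj2 (IH i)).
Qed.

Lemma linked_sym M M' G G' (X : Type) (v : X -> dom M) (v' : X -> dom M') :
  linked G G' v v' -> linked G' G v' v.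
Proof.
move=> [A [A' [f [fP vv']]]]; have [g gP gf] := partial_iso_inv fP.
exists A', A, g; split=> // x; have [Ax ->] := vv' x; rewrite gf //; split=> //.
by case: fP => _ /iso_emb fE _ _; exact: emb_dom fE Ax.
Qed.

Lemma linked_extend M M' G G' (X Y : Type) (v : X -> dom M) (v' : X -> dom M')
    (w : Y -> dom M) :
  rich M G -> rich M' G' -> [set: Y] #<= [set: kappa] -> linked G G' v v' ->
  exists w' : Y -> dom M', linked G G'
    (fun z => match z with inl x => v x | inr y => w y end)
    (fun z => match z with inl x => v' x | inr y => w' y end).
Proof.
move=> MG MG' Yk [A [A' [f [fP vv']]]].
have [||B [B' [g [gP AB ZB gf]]]] :=
    partial_iso_extend (Z := range (fun y => val (w y))) MG MG' fP.
- by move=> _ [y _ <-]; exact: elt_dom.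
- exact: card_le_trans (card_image_le _ _) Yk.
have gM' y : dom M' (g (val (w y))).
  have [_ /iso_emb gE _ [X' GX' B'X']] := gP.
  case: MG' => /(_ _ GX')[_ X'M'] _ _; apply: (emb_dom X'M').
  by apply: (le_dom_sub B'X'); apply: (emb_dom gE); apply: ZB; exists y.
exists (fun y => elt (gM' y)), B, B', g; split=> // -[x|y]; last first.
  by split=> //; apply: ZB; exists y.
by have [Ax E] := vv' x; split; [exact: AB|rewrite gf].
Qed.

(** A quantifier block has fewer than kappa^+ variables, so at most kappa: just what one extension
    of a partial isomorphism can absorb. *)
Lemma linked_sat M M' G G' (X : Type) (phi : formula L W X) v v' :
  rich M G -> rich M' G' -> linked G G' v v' ->
  sat (str M) phi v <-> sat (str M') phi v'.
Proof.
move=> MG MG'; elim: phi v v' => {X} [X t u|X r t|X phi IH|X J phi IH|X Y Yt phi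
  IH]
  v v' vv' /=.
- have [A [A' [f [fP vf]]]] := vv'.
  have [AM AM'] := partial_iso_emb MG MG' fP.
  have [tA tf] := linked_eval t AM AM' vf; have [uA uf] :=
    linked_eval u AM AM' vf.
  split=> E; first by apply: val_inj; rewrite tf uf E.
  by apply: val_inj; apply: (emb_inj AM') => //; rewrite -tf -uf E.
- have [A [A' [f [fP vf]]]] := vv'.
  have [AM AM'] := partial_iso_emb MG MG' fP.
  have tA i := linked_eval (t i) AM AM' vf.
  pose w i := elt (proj1 (tA i)).
  rewrite -(@emb_rel _ _ _ _ _ _ w _ AM) //.
  rewrite -(@emb_rel _ _ _ _ _ _ w (fun i => eval (str M') v' (t i)) AM') // =>
    i.
  exact: (proj2 (tA i)).
- by split=> nphi phiv; apply: nphi; apply/(IH v v').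
- by split=> h j; apply/(IH j v v').
- have Yk := succ_card_lt Wsucc Yt.
  split=> -[w wphi].
    have [w' ww'] := linked_extend w MG MG' Yk vv'.
    by exists w'; exact: (proj1 (IH _ _ ww') wphi).
  have [w' ww'] := linked_extend w MG' MG Yk (linked_sym vv').
  by exists w'; exact: (proj2 (IH _ _ (linked_sym ww')) wphi).
Qed.

(** A sentence has no free variables, so any partial isomorphism is a start; the identity of a
    common piece is one. *)
Lemma rich_equiv M M' G G' : rich M G -> rich M' G' ->
  (exists2 X, G X & G' X) -> Linf_equiv W (str M) (str M').
Proof.
move=> MG MG' [X GX GX'] phi; apply: (linked_sat _ MG MG').
have [KX _] : Kkappa X /\ emb X M id by case: MG => + _ _; apply.
exists X, X, id; split; last by case.
split=> //; first exact: iso_id.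
  by exists X => //; exact: (Defs.le_refl HA (proj1 KX)).
by exists X => //; exact: (Defs.le_refl HA (proj1 KX)).
Qed.

(** * Clubs avoiding the non-reflecting set *)

Lemma card_le_enum (T U : Type) (t0 : T) (A : set T) (u0 : U) :
  A #<= [set: U] -> exists e : U -> T, forall x, A x -> exists u, e u = x.
Proof.
move=> /(card_le_fun u0)[f [_ fi]].
have /choice[e eP] : forall u, exists y, (exists2 x,
  A x & f x = u) -> A y /\ f y = u.
  move=> u; have [[x Ax <-]|h] := pselect (exists2 x, A x & f x = u);
    first by exists x.
  by exists t0.
exists e => x Ax; exists (f x).
by have [|Ae fe] := eP (f x); [exists x|exact: fi].
Qed.

Variables (lam : wellorder) (S : set W).
Hypothesis lamreg : is_regular_cardinal lam.
Hypothesis Scof : forall a, S a -> has_cofinality (seg a) lam.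
Hypothesis Snonreflecting : forall a : W, is_limit_ordinal (seg a) ->
  uncountable_cofinality (seg a) -> ~ stationary [set x : seg a | S (val x)].

Lemma S_limit a : S a -> is_limit a.
Proof.
by move=> /Scof/cofinality_limit => h; apply/is_limitE/h; case: lamreg.
Qed.

Lemma lam_limit : is_limit_ordinal lam.
Proof. by case: lamreg => _ h; exact: cofinality_limit. Qed.

Definition avoiding_club (a : W) (C : set W) : Prop :=
  [/\ forall x, C x -> wo_lt x a /\ ~ S x,
      forall x, wo_lt x a -> exists2 c, C c & wo_le x c
    & forall b, wo_lt b a -> is_limit b ->
        (forall x, wo_lt x b -> exists2 c,
          C c & wo_le x c /\ wo_lt c b) -> C b].

(** Non-reflection says nothing at countable cofinality. There a cofinal sequence of successor
    ordinals of length omega suffices: it misses [S], whose members are limits, and has no limit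
    point below [a]. *)
Lemma avoiding_club_omega (a : W) (Y : set (seg a)) : is_limit a ->
  cofinal Y -> countable Y -> exists C : set W, avoiding_club a C.
Proof.
move=> la Ycof Yc; have [[y0 y0a] _] := la.
have [e eP] := card_le_enum (to_seg y0a) 0 Yc.
have /choice[step stepP] : forall p : nat * W, exists y, wo_lt p.2 a ->
    [/\ wo_lt y a, wo_lt p.2 y, wo_lt (val (e p.1)) y & exists c, is_succ c y].
  move=> [n x] /=; have [xa|h] := pselect (wo_lt x a); last by exists x.
  have [m [xm em ma]] : exists m, [/\ wo_le x m,
    wo_le (val (e n)) m & wo_lt m a].
    have [xe|ex] := wo_total x (val (e n)).
      by exists (val (e n)); split=> //; [exact: wo_refl|exact: seg_val_lt].
    by exists x; split=> //; exact: wo_refl.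
  have [y my ya] := limit_succ la ma; exists y => _; split=> //.
  - exact: wo_le_lt_trans xm (proj1 my).
  - exact: wo_le_lt_trans em (proj1 my).
  - by exists m.
pose c := fix c n := if n is n'.+1 then step (n', c n') else step (0, y0).
have ca n : wo_lt (c n) a.
  by elim: n => [|n IH] /=; [case: (stepP (0, y0) y0a)|case: (stepP (n,
    c n) IH)].
have cS n : wo_lt (c n) (c n.+1) by case: (stepP (n, c n) (ca n)).
have ce n : wo_lt (val (e n)) (c n.+1) by case: (stepP (n, c n) (ca n)).
have csucc n : exists p, is_succ p (c n).
  by case: n => [|n]; [case: (stepP (0, y0) y0a)|case: (stepP (n, c n) (ca n))].
have cmono m n : m <= n -> wo_le (c m) (c n).
  elim: n => [|n IH]; first by rewrite leqn0 => /eqP ->; exact: wo_refl.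
  rewrite leq_eqVlt => /orP[/eqP ->|]; first exact: wo_refl.
  by rewrite ltnS => /IH h; apply: wo_le_trans h _; exact: wo_ltW.
have ccof x : wo_lt x a -> exists n, wo_le x (c n).
  move=> xa; have [y Yy xy] := Ycof (to_seg xa); have [n ny] := eP y Yy.
  exists n.+1; apply: wo_ltW; apply: wo_le_lt_trans (ce n).
  by rewrite ny.
exists (range c); split.
- move=> _ [n _ <-]; split; first exact: ca.
  by move=> /S_limit; have [p /succ_not_limit] := csucc n.
- by move=> x /ccof[n xn]; exists (c n) => //; exists n.
- move=> b ba lb bcof; exfalso; have [n bn] := ccof b ba.
  (* A limit [b] approached by the sequence would lie above all its terms: once [c k] is below [b],
     a term below [b] but above [c k] has index beyond [k], so [c k.+1] is below [b] as well. *)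
  suff cb k : wo_lt (c k) b by exact: wo_lt_nle (cb n) bn.
  elim: k => [|k IH].
    have [[x xb] _] := lb; have [_ [m _ <-] [_ mb]] := bcof x xb.
    by apply: wo_le_lt_trans mb; exact: cmono.
  have [y ky yb] := limit_succ lb IH; have [_ [m _ <-] [ym mb]] := bcof y yb.
  apply: wo_le_lt_trans mb; apply: (cmono); rewrite ltnNge; apply/negP => mk.
  have := wo_le_trans ym (cmono _ _ mk); exact: wo_lt_nle (proj1 ky).
Qed.

Lemma avoiding_club_exists (a : W) : is_limit a -> exists C : set W,
  avoiding_club a C.
Proof.
move=> la.
have [unc|/existsNP[Y /not_implyP[Ycof /contrapT Yc]]] :=
    pselect (uncountable_cofinality (seg a));
      last exact: avoiding_club_omega Yc.
have /existsNP[C0 /not_implyP[[C0cof C0cl] C0S]] :=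
  Snonreflecting (proj2 (is_limitE a) la) unc.
exists [set val x | x in C0]; split.
- move=> _ [x C0x <-]; split; first exact: seg_val_lt.
  by move=> Sx; apply: C0S; exists x.
- move=> x xa; have [c Cc xc] := C0cof (to_seg xa).
  by exists (val c) => //; exists c.
- move=> b ba lb bcof; exists (to_seg ba) => //; apply: C0cl.
    by apply/is_limitE/is_limit_seg.
  move=> x; have xb : wo_lt (val (val x)) b by move/seg_lt: (seg_val_lt x).
  have [_ [c C0c <-] [xc cb]] := bcof _ xb.
  have cb' : wo_lt c (to_seg ba) by apply/seg_lt.
  by exists (to_seg cb').
Qed.

(** All values avoid [S], for three reasons: the first is zero, those at successor indices are
    successors of points of [C], and those at limit indices are suprema of points of [C]. Successor
    values are also wanted because only successor stages of the chain are limit models over earlier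
    ones. *)
Lemma cofinal_sequence (a : W) (C : set W) : S a -> avoiding_club a C ->
  exists q : lam -> W, [/\ forall i, wo_lt (q i) a /\ ~ S (q i),
    forall i, is_zero i -> is_zero (q i),
    forall i j, wo_lt i j -> wo_lt (q i) (q j),
    forall i j, is_succ i j -> exists c, is_succ c (q j)
  & (forall i, is_limit i -> is_limit (q i) /\
      forall y, wo_lt y (q i) -> exists2 j, wo_lt j i & wo_le y (q j)) /\
    forall x, wo_lt x a -> exists i, wo_le x (q i)].
Proof.
move=> Sa [CS Ccof Ccl]; have la := S_limit Sa; have [[y0 y0a] _] := la.
have [[l0] lnomax] := lam_limit.
have [[Y Ycof /card_eqPle[Yl _]] lmin] := Scof Sa.
have [e eP] := card_le_enum (to_seg y0a) l0 Yl.
pose P (i : lam) (q : lam -> W) x := [/\ wo_lt x a,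
  forall j, wo_lt j i -> wo_lt (q j) x, is_zero i -> is_zero x,
  is_limit i -> forall y, wo_lt y x -> exists2 j, wo_lt j i & wo_le y (q j)
  & forall j, is_succ j i -> wo_lt (val (e j)) x /\ exists2 c,
    C c & is_succ c x].
have [||q qP] := @wo_recursion lam _ y0 P.
- move=> i q q' x qq' [xa qx zx lx sx]; split=> //.
    by move=> j ji; rewrite -qq' //; exact: qx.
  by move=> li y /(lx li)[j ji yj]; exists j => //; rewrite -qq'.
- move=> i q IH; have [zi|[j ji]|li] := zero_succ_limit i.
  + have [z zz] := exists_zero y0; exists z; split=> //.
    * exact: wo_le_lt_trans (zero_le _ zz) y0a.
    * by move=> j /zi.
    * by move=> /limit_not_zero.
    * by move=> j /succ_not_zero.
  + have [qja qlt _ _ _] := IH j (proj1 ji).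
    have [m [qm em ma]] : exists m, [/\ wo_le (q j) m,
      wo_le (val (e j)) m & wo_lt m a].
      have [xe|ex] := wo_total (q j) (val (e j)).
        by exists (val (e j)); split=> //; [exact: wo_refl|exact: seg_val_lt].
      by exists (q j); split=> //; exact: wo_refl.
    have [c Cc mc] := Ccof m ma; have [x cx xa] :=
      limit_succ la (proj1 (CS c Cc)).
    have mx := wo_le_lt_trans mc (proj1 cx).
    exists x; split=> //.
    * move=> k /(succ_le ji)/wo_le_eqVlt[->|/qlt kj];
        first exact: wo_le_lt_trans qm mx.
      by apply: wo_lt_trans kj _; exact: wo_le_lt_trans qm mx.
    * by move=> /(succ_not_zero ji).
    * by move=> /(succ_not_limit ji).
    * move=> k /(succ_inj ji) <-; split; last by exists c.
      exact: wo_le_lt_trans em mx.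
  (* The earlier values are bounded below [a]: otherwise they would be cofinal, and [seg i], smaller
     than the initial ordinal [lam], would be at least as large as the cofinality of [a]. *)
  + have [x xa qx] : exists2 x, wo_lt x a & forall j,
      wo_lt j i -> wo_lt (q j) x.
      apply: contrapT => h.
      pose Z : set (seg a) := [set u | exists2 j, wo_lt j i & val u = q j].
      have Zcof : cofinal Z.
        move=> u; apply: contrapT => nZ; apply: h; exists (val u);
          first exact: seg_val_lt.
        move=> j ji; apply: wo_nle => uj; apply: nZ.
        have [qja _ _ _ _] := IH j ji.
        by exists (to_seg qja) => //; exists j.
      have [_ nil] : card_lt (seg i) lam by case: lamreg => + _ _; exact.
      apply: nil; apply: card_le_trans (lmin _ Zcof) _.
      apply: (@rel_card_le _ _ _ _ (fun u (j : seg i) => val u = q (val j))).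
        by move=> u [j ji uj]; exists (to_seg ji).
      by move=> u u' j _ _ E E'; apply: val_inj; rewrite E E'.
    have [|s [sup sx scof]] := @exists_lub _ (q @` [set j | wo_lt j i]) x.
      by move=> _ [j ji <-]; exact: qx.
    exists s; split=> //.
    * exact: wo_le_lt_trans sx xa.
    * by move=> j ji; apply: sup; exists j.
    * by move=> /(limit_not_zero li).
    * by move=> _ y /scof[_ [j ji <-] yj]; exists j.
    * by move=> j /succ_not_limit.
have qmono i j : wo_lt i j -> wo_lt (q i) (q j) by case: (qP j) => _ + _ _ _;
  exact.
have qlim i : is_limit i -> is_limit (q i) /\ C (q i).
  move=> li; have [qa _ _ /(_ li) qcof _] := qP i; have [[j0 j0i] _] := li.
  have lq : is_limit (q i).
    apply: (@lub_limit _ (q @` [set j | wo_lt j i])).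
    - by exists (q j0), j0.
    - by move=> _ [j ji <-]; exact: qmono.
    - by move=> y /qcof[j ji yj]; exists (q j) => //; exists j.
    - move=> _ [j ji <-]; have [k jk ki] := limit_succ li ji.
      by exists (q k); [exists k|exact: qmono (proj1 jk)].
  split=> //; apply: Ccl => // y /qcof[j ji yj].
  (* The points of [C] just below the values at successor indices interleave with the sequence, so
     [q i] is a limit of [C]. *)
  have [k jk ki] := limit_succ li ji; have [_ _ _ _ /(_ _ jk)[_ [c Cc ck]]] :=
    qP k.
  exists c => //; split; last exact: wo_lt_trans (proj1 ck) (qmono _ _ ki).
  by apply: wo_le_trans yj _; apply: (succ_le ck); exact: qmono (proj1 jk).
exists q; split.
- move=> i; have [qa _ qz _ qs] := qP i; split=> // Sq; have lq := S_limit Sq.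
  have [/qz|[j /qs[_ [c _ /succ_not_limit]]]|/qlim[_ Cq]] // :=
    zero_succ_limit i.
    exact: limit_not_zero.
  by have [_] := CS _ Cq; exact.
- by move=> i; case: (qP i).
- exact: qmono.
- by move=> i j ij; have [_ _ _ _ /(_ i ij)[_ [c _ cj]]] := qP j; exists c.
- split; first by move=> i li; split;
    [case: (qlim i li)|case: (qP i) => _ _ _ + _; exact].
  move=> x xa; have [y Yy xy] := Ycof (to_seg xa); have [i iy] := eP y Yy.
  have [j ij] := limit_ordinal_is_limit lam_limit i; exists j.
  have [_ _ _ _ /(_ i ij)[ej _]] := qP j; apply: wo_ltW;
    apply: wo_le_lt_trans ej.
  by rewrite iy.
Qed.

(** * The chain *)

Lemma sum_card_kappa A B : Kkappa A -> Kkappa B ->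
  [set: dom A + dom B + mu] #= [set: kappa].
Proof.
move=> [_ cA] KB; apply: Cantor_Bernstein.
  apply: sum_card_le => //; last exact: mu_kappa.
  apply: sum_card_le => //; rewrite (card_le_eql (set_type_card _)).
    by case/card_eqPle: cA.
  exact: Kkappa_le_card.
case/card_eqPle: cA => _ kA; apply: card_le_trans kA _.
rewrite -(card_le_eql (set_type_card (dom A))).
by apply: (@fun_card_le _ _ _ _ (fun a => inl (inl a))) => // x y _ _ [].
Qed.

Lemma coherent_le_iso A B A' B' f : iso A' A f -> iso B' B f ->
  Kkappa A' -> Kkappa B' -> emb A' B' id ->
  coherent_le K le mu A B -> coherent_le K le mu A' B'.
Proof.
move=> fA fB KA' KB' A'B' [_ _ _ [C [h [KC cC AC hS hA]]]].
have KA := Kkappa_iso fA KA'; have KB := Kkappa_iso fB KB'.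
have KkC : Kkappa C by split=> //; rewrite /has_card (card_eql cC);
  exact: sum_card_kappa.
have [h' hh'] := fun_total h; have h'S := strong_embedding_strong hS hh'.
have [g [gI gf fg]] := iso_inv fA; have [x0 _] := V_point.
(* The witness is copied along the inverse of [f], so that it contains [A'] literally, as
   [coherent_le] demands. *)
have [|C' [g' [g'I g'g A'C']]] := extend_iso x0 gI (le_emb AC).
  apply: card_room; first exact: Kkappa_le_card.
  by apply: card_le_trans (Kkappa_le_card KkC); apply: subset_card_le => x;
    case.
have KC' := Kkappa_iso g'I KkC.
have leA'C' : le A' C' by apply: le_iso_map gI g'I _ AC => x /g'g.
have kS : strong B' C' (g' \o (h' \o f)).
  apply: strong_comp; last first.
    by exists C'; [exact: g'I|exact: (Defs.le_refl HA (proj1 KC'))].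
  apply: strong_comp h'S.
  by exists B; [exact: fB|exact: (Defs.le_refl HA (proj1 KB))].
have [k kE kk] := strong_strong_embedding kS.
split; [by case: KA'|by case: KB'|by []|exists C', k; split=> //].
- by case: KC'.
- by rewrite /has_card (card_eql (proj2 KC')); apply: card_esym;
    exact: sum_card_kappa.
- move=> b A'b; rewrite kk /=.
  have Af : dom A (f (val b)) by exact: emb_dom (iso_emb fA) A'b.
  have Bf : dom B (f (val b)) by exact: emb_dom (iso_emb fB) (elt_dom b).
  by have := hh' (elt Bf); rewrite hA // => <-; rewrite g'g //= gf.
Qed.

(** Along [C] the stages form a strong chain because [C] avoids [S]. A stage outside both [C] and
    [S] is strong in the union through the next stage from [C]. *)
Lemma avoiding_club_union (a : W) (C : set W) (F : W -> structure L V) U :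
  is_limit a -> avoiding_club a C ->
  (forall i, wo_lt i a -> K (F i)) ->
  (forall i j, wo_lt i j -> wo_lt j a -> emb (F i) (F j) id) ->
  (forall i j, wo_lt i j -> wo_lt j a -> ~ S i -> le (F i) (F j)) ->
  (forall i, wo_lt i a -> is_limit i ->
    dom (F i) `<=` \bigcup_(j in [set j | wo_lt j i]) dom (F j)) ->
  is_union_on [set i | wo_lt i a] F U ->
  K U /\ forall i, wo_lt i a -> ~ S i -> le (F i) U.
Proof.
move=> la [CS Ccof Ccl] FK Finc Fle Fcont FU.
have [[y0 y0a] lim_a] := la.
have cofC i : wo_lt i a -> exists2 c, C c & wo_lt i c.
  by move=> ia; have [j ij ja] := lim_a i ia; have [c Cc jc] := Ccof j ja;
    exists c => //; exact: wo_lt_le_trans ij jc.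
have Fsub i j : wo_lt i j -> wo_lt j a -> dom (F i) `<=` dom (F j).
  by move=> ij ja x Fx; exact: emb_dom (Finc _ _ ij ja) Fx.
have CU : is_union_on C F U.
  case: FU => UE FU; split; last by move=> c /CS[ca _]; exact: FU.
  rewrite UE; apply/seteqP; split=> x [i]; last by move=> /CS[ia _]; exists i.
  move=> ia Fx; have [c Cc ic] := cofC i ia; exists c => //.
  by apply: Fsub ic _ _ Fx; case: (CS c Cc).
have [|||||KU leU] := chain_union _ _ _ _ _ CU.
- by have [c Cc _] := cofC y0 y0a; exists c.
- by move=> i /CS[ia _]; exact: cofC.
- by move=> i /CS[ia _]; exact: FK.
- by move=> i j /CS[_ nSi] /CS[ja _] ij; exact: Fle.
- move=> i Ci [j0 Cj0 j0i] lim_i x Fx; have [ia _] := CS i Ci.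
  pose X := [set j | C j /\ wo_lt j i].
  have [|s [sup si scof]] := @exists_lub _ X i; first by move=> j [].
  have ls : is_limit s.
    apply: (@lub_limit _ X) => //; first by exists j0.
    by move=> j [Cj ji]; have [k Ck [jk ki]] := lim_i j Cj ji; exists k.
  have Cs : C s.
    apply: Ccl => //; first exact: wo_le_lt_trans si ia.
    by move=> y /scof[j [Cj ji] yj]; exists j => //; split=> //; exact: sup.
  (* Closedness makes [i] the supremum in [W] of the points of [C] below it: a supremum [s] below
     [i] would be one of those points, hence below itself. *)
  have E : s = i.
    have [//|lt] := wo_le_eqVlt si; exfalso; apply: (@wo_ltnn _ s); exact: sup.
  rewrite E in ls scof.
  have [j ji Fj] := Fcont i ia ls x Fx; have [k [Ck ki] jk] := scof j ji.
  exists k => //; have [<-//|lt] := wo_le_eqVlt jk.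
  exact: Fsub lt (wo_lt_trans ki ia) _ Fj.
split=> // i ia nSi; have [c Cc ic] := cofC i ia.
by apply: le_trans_class (leU c Cc); apply: Fle => //; case: (CS c Cc).
Qed.

Variables (Ac : lam -> structure L V) (Bc Uc : structure L V).
Hypothesis AcK : forall i, Kkappa (Ac i).
Hypothesis Ac_le : forall i j, wo_lt i j -> le (Ac i) (Ac j).
Hypothesis Ac_limit : forall i, is_limit i ->
  is_union_on [set j | wo_lt j i] Ac (Ac i).
Hypothesis Ac_succ : forall i j, is_succ i j -> limit_model (Ac i) (Ac j).
Hypothesis Bc_limit : forall i, limit_model (Ac i) Bc.
Hypothesis AcU : is_union Ac Uc.
Hypothesis UcBc : ~ coherent_le K le mu Uc Bc.
Variable l0 : lam.
Hypothesis l0z : is_zero l0.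

(** Starting at [Ac l0] lets the comparison with the chain of CP begin at zero. After a bad [k] the
    limit clause speaks only of [j] below [k], and keeps these stages strong in [B] although [g k]
    is not. *)
Definition main_step (i : W) (g : W -> structure L V) B : Prop :=
  [/\ Kkappa B, is_zero i -> B = Ac l0,
      forall j, wo_lt j i -> emb (g j) B id /\ (~ S j -> le (g j) B),
      is_limit i -> dom B `<=` \bigcup_(j in [set j | wo_lt j i]) dom (g j)
    & forall k, is_succ k i ->
        (forall j, wo_le j k -> ~ S j -> limit_model (g j) B) /\
        (S k -> ~ coherent_le K le mu (g k) B)].

Lemma bad_extension (k : W) (g : W -> structure L V) : S k ->
  (forall j, wo_le j k -> main_step j g (g j)) ->
  exists B, [/\ Kkappa B, emb (g k) B id,
    forall j, wo_lt j k -> ~ S j -> limit_model (g j) B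
  & ~ coherent_le K le mu (g k) B].
Proof.
move=> Sk IH; have [C kC] := avoiding_club_exists (S_limit Sk).
have [q [qS qz qmono qs [ql qcof]]] := cofinal_sequence Sk kC.
have qk i : wo_lt (q i) k by case: (qS i).
have IHq i : main_step (q i) g (g (q i)) by apply: IH; exact: wo_ltW.
have gle i j : wo_lt i j -> wo_le j k -> ~ S i -> le (g i) (g j).
  by move=> ij /IH[_ _ /(_ i ij)[_ h] _ _]; exact: h.
have gemb i j : wo_lt i j -> wo_le j k -> emb (g i) (g j) id.
  by move=> ij /IH[_ _ /(_ i ij)[h _] _ _].
have gsub i j : wo_le i j -> wo_le j k -> dom (g i) `<=` dom (g j).
  move=> /wo_le_eqVlt[E|ij] jk x gx; first by rewrite -E.
  exact: emb_dom (gemb _ _ ij jk) gx.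
have gq_le i j : wo_lt i j -> le (g (q i)) (g (q j)).
  by move=> ij; apply: gle; [exact: qmono|exact: wo_ltW|case: (qS i)].
have Ac_inc (J : set lam) : increasing_on J Ac.
  by apply: le_increasing_on => i j _ _; exact: Ac_le.
have Ac_sub i j : wo_le i j -> dom (Ac i) `<=` dom (Ac j).
  by move=> /wo_le_eqVlt[->//|/Ac_le/le_dom_sub].
pose P (i : lam) (F : lam -> V -> V) (h : V -> V) :=
  iso (Ac i) (g (q i)) h /\
  forall j, wo_lt j i -> forall x, dom (Ac j) x -> h x = F j x.
have [||F FP] := @wo_recursion lam _ id P.
- move=> i F F' h FF' [hI hF]; split=> // j ji x Ax.
  by rewrite -FF' //; exact: hF.
- move=> i F IHF; have [zi|[j ji]|li] := zero_succ_limit i.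
  + exists id; split; last by move=> j /zi.
    have [_ E _ _ _] := IHq i; rewrite (E (qz i zi)) (zero_uniq zi l0z).
    exact: iso_id.
  + have [FI FF] := IHF j (proj1 ji); have [c cq] := qs _ _ ji.
    (* [q i] is the successor of [c] and [q j] is at most [c], so [g (q i)] is a limit model over
       [g (q j)], as [Ac i] is over [Ac j]; uniqueness extends the isomorphism. *)
    have [_ _ _ _ /(_ c cq)[glim _]] := IHq i.
    have qjc : wo_le (q j) c by apply: (succ_le cq); exact: qmono (proj1 ji).
    have [h hF hI] := limit_model_unique FI (Ac_succ ji) (glim _ qjc (proj2 (qS
      j))).
    exists h; split=> // l /(succ_le ji) lj x Ax; rewrite hF;
      last exact: Ac_sub lj _ Ax.
    by have [->|lj'] := wo_le_eqVlt lj => //; exact: FF.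
  + have [j l x|h hF] := @glue_maps V lam
        (fun j => [set x | wo_lt j i /\ dom (Ac j) x]) F.
      move=> [ji Aj] [li' Al]; have [/wo_le_eqVlt[-> //|jl]|/wo_le_eqVlt[->
        //|lj]] := wo_total j l.
        by have [_ E] := IHF l li'; rewrite (E j).
      by have [_ E] := IHF j ji; rewrite (E l).
    exists h; split; last by move=> j ji x Ax; rewrite (hF j).
    have [lq qcofi] := ql i li.
    have gU : is_union_on [set j | wo_lt j i] (fun j => g (q j)) (g (q i)).
      split; last by move=> j ji; exact: le_emb (gq_le _ _ ji).
      apply/seteqP; split=> x.
        have [_ _ _ /(_ lq) h' _] := IHq i; move=> /h'[y yq gx].
        have [j ji yj] := qcofi y yq; exists j => //.
        by apply: gsub gx => //; exact: wo_ltW.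
      by move=> [j ji]; apply: le_dom_sub; exact: gq_le.
    apply: (union_on_iso _ (Ac_inc _) (Ac_limit li) gU); first by case: li.
    move=> j ji; have [FI _] := IHF j ji; apply: iso_ext FI => x Ax.
    by rewrite (hF j).
have [i j x Ai Aj|f fF] := @glue_maps V lam (fun i => dom (Ac i)) F.
  have [/wo_le_eqVlt[-> //|ij]|/wo_le_eqVlt[-> //|ji]] := wo_total i j.
    by have [_ E] := FP j; rewrite (E i).
  by have [_ E] := FP i; rewrite (E j).
have fI i : iso (Ac i) (g (q i)) f.
  have [FI _] := FP i; by apply: iso_ext FI => x Ax; rewrite (fF i).
have AcUT := proj1 (is_union_setT _ _) AcU.
have lk := S_limit Sk; have kk := wo_refl k.
have gU : is_union_on setT (fun i => g (q i)) (g k).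
  split; last by move=> i _; apply: le_emb; apply: gle => //; case: (qS i).
  apply/seteqP; split=> x.
    have [_ _ _ /(_ lk) h _] := IH k kk; move=> /h[y yk gx].
    have [i yi] := qcof y yk; exists i => //.
    by apply: gsub gx => //; exact: wo_ltW.
  by move=> [i _]; apply: gsub => //; exact: wo_ltW.
have T0 : [set: lam] !=set0 by exists l0.
have fU : iso Uc (g k) f by apply: (union_on_iso T0 (Ac_inc _) AcUT gU).
have UB : emb Uc Bc id.
  apply: (union_on_emb T0 (Ac_inc _) AcUT) => i _.
  by have [_ _ /le_emb] := limit_model_Kkappa (Bc_limit i).
have [_ KB _] := limit_model_Kkappa (Bc_limit l0).
have KgK : Kkappa (g k) by case: (IH k kk).
have [x0 _] := V_point.
have [|B [h [hI hf kB]]] := extend_iso x0 fU UB.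
  apply: card_room; first exact: Kkappa_le_card.
  by apply: card_le_trans (Kkappa_le_card KB); apply: subset_card_le => x; case.
have AcsubU i : dom (Ac i) `<=` dom Uc by case: AcU => -> _ x Ax; exists i.
have UI : iso Uc (g k) h by apply: iso_ext fU => x /hf.
exists B; split=> //.
- exact: Kkappa_iso hI KB.
(* Here CP's requirement that [Bc] be a limit over every [Ac i] is needed: it makes [B] a limit over
   cofinally many [g (q i)], and then over every earlier [g j] with [j] outside [S]. *)
- move=> j jk nSj; have [i ji] := qcof j jk.
  have qB : limit_model (g (q i)) B.
    apply: limit_model_iso _ hI (Bc_limit i).
    by apply: iso_ext (fI i) => x /AcsubU/hf.
  have [->//|ji'] := wo_le_eqVlt ji.
  apply: limit_model_le_l qB; first by case: (IH j (wo_ltW jk)).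
  by apply: gle => //; exact: wo_ltW.
- have [g' [g'I _ _]] := iso_inv UI; have KU := Kkappa_iso g'I KgK.
  by move=> cB; apply: UcBc; exact: coherent_le_iso UI hI KU KB UB cB.
Qed.

Lemma main_chain_exists : exists M : W -> structure L V, forall i,
  main_step i M (M i).
Proof.
apply: (@wo_recursion W _ (Ac l0) main_step).
- move=> i g g' B gg' [KB zB eB cB sB]; split=> //.
  + by move=> j ji; rewrite -gg' //; exact: eB.
  + by move=> li x /(cB li)[j ji gx]; exists j => //; rewrite -gg'.
  + move=> k ki; have [limB nB] := sB k ki; split=> [j jk nSj|].
      rewrite -gg'; first exact: limB.
      exact: wo_le_lt_trans jk (proj1 ki).
    by rewrite -gg' //; case: ki.
- move=> i g IH; have gle j k : wo_lt j k -> wo_lt k i -> ~ S j -> le (g j) (g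
    k).
    by move=> jk /IH[_ _ /(_ j jk)[_ h] _ _]; exact: h.
  have gemb j k : wo_lt j k -> wo_lt k i -> emb (g j) (g k) id.
    by move=> jk /IH[_ _ /(_ j jk)[h _] _ _].
  have [zi|[k ki]|li] := zero_succ_limit i.
  + exists (Ac l0); split=> //.
    * by move=> j /zi.
    * by move=> /limit_not_zero.
    * by move=> j /succ_not_zero.
  + have ki' := proj1 ki.
    have IHk j : wo_le j k -> main_step j g (g j).
      by move=> jk; apply: IH; exact: wo_le_lt_trans jk ki'.
    suff [B [KB kB Bl Bn]] : exists B, [/\ Kkappa B, emb (g k) B id,
        forall j, wo_le j k -> ~ S j -> limit_model (g j) B
      & S k -> ~ coherent_le K le mu (g k) B].
      exists B; split=> //.
      * by move=> /(succ_not_zero ki).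
      * move=> j /(succ_le ki) jk; split;
          last by move=> /(Bl j jk)/limit_model_Kkappa[].
        have [->//|jk'] := wo_le_eqVlt jk.
        exact: (@emb_comp _ _ _ _ _ id id (gemb _ _ jk' ki') kB).
      * by move=> /(succ_not_limit ki).
      * by move=> l /(succ_inj ki) <-.
    have [Sk|nSk] := pselect (S k).
      have [B [KB kB Bl Bn]] := bad_extension Sk IHk; exists B; split=> //.
      by move=> j /wo_le_eqVlt[-> //|]; exact: Bl.
    have Kgk : Kkappa (g k) by case: (IHk k (wo_refl k)).
    have [B kB] := limit_model_exists Kgk; have [_ KB leB] :=
      limit_model_Kkappa kB.
    exists B; split=> //; first exact: le_emb.
    move=> j /wo_le_eqVlt[-> //|jk] nSj; apply: limit_model_le_l kB.
      by case: (IHk j (wo_ltW jk)).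
    exact: gle.
  + have [C aC] := avoiding_club_exists li.
    have [||U gU] := @union_on_exists _ _ W [set j | wo_lt j i] g.
    * by case: li.
    * by move=> j k _ ki' jk; exact: gemb.
    have [||||KU leU] := avoiding_club_union li aC _ _ _ _ gU.
    * by move=> j /IH[[]].
    * exact: gemb.
    * exact: gle.
    * by move=> j /IH[].
    exists U; split=> //.
    * apply: Kkappa_intro => //.
        have [[j ji] _] := li; exists (g j); first by case: (IH j ji).
        by case: gU => -> _ x gx; exists j.
      apply: union_on_card_le gU => //; first exact: (seg_card_le Wsucc).
      by move=> j /IH[/Kkappa_le_card].
    * by move=> /(limit_not_zero li).
    * by move=> j ji; split; [case: gU => _; exact|exact: leU].
    * by move=> _ x; case: gU => ->.
    * by move=> k /succ_not_limit.
Qed.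

(** * The union of the chain *)

Lemma emb_same_dom A B U : emb A U id -> emb B U id -> dom A = dom B -> A = B.
Proof.
move=> AU BU E; apply: emb_eq; last by rewrite E.
by apply: (emb_cancel AU BU) => // x; rewrite E.
Qed.

Lemma W_limit : is_limit_ordinal W.
Proof. exact: (succ_card_limit kinf Wsucc). Qed.

Lemma bounded_in_union (N : W -> set V) (Y : set V) :
  Y `<=` \bigcup_i N i -> Y #<= [set: kappa] ->
  exists b, forall y, Y y -> exists2 i, wo_lt i b & N i y.
Proof.
move=> YN Yk; have [[w0] _] := W_limit.
have /choice[r rP] : forall y, exists i, Y y -> N i y.
  move=> y; have [/YN[i _ Ny]|nY] := pselect (Y y); first by exists i.
  by exists w0.
have [b bP] := succ_card_bounded kinf Wsucc (card_le_trans (card_image_le r Y)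
  Yk).
by exists b => y Yy; exists (r y); [apply: bP; exists y|exact: rP].
Qed.

(** [J] is the complement of [S] for the constructed chain and everything for a strong chain. It
    must contain the successors, where pieces above a given bound are found. *)
Lemma rich_of_chain (J : set W) (N : W -> structure L V) U :
  (forall i, Kkappa (N i)) -> (forall i j, wo_lt i j -> emb (N i) (N j) id) ->
  (forall i j, wo_lt i j -> J i -> le (N i) (N j)) ->
  (forall i j, is_succ i j -> J j) ->
  (forall i j, J i -> is_succ i j -> univ (N i) (N j)) ->
  is_union N U -> rich U (N @` J).
Proof.
move=> KN Ninc Nle Jsucc Nuniv [UE NU]; have Wlim :=
  limit_ordinal_is_limit W_limit.
split.
- by move=> _ [i _ <-]; split=> //; exact: NU.
- move=> _ Y [i Ji <-] YU Yk.
  have [|b bP] := @bounded_in_union (fun i => dom (N i)) Y _ Yk;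
    first by rewrite -UE.
  have [z iz bz] := ordinal_bounded2 W_limit i b; have [j zj] := Wlim z.
  exists (N j); split; first by exists j => //; exact: Jsucc zj.
    by apply: Nle => //; exact: wo_lt_trans iz (proj1 zj).
  move=> y /bP[k kb Ny]; apply: (emb_dom (Ninc k j _) Ny).
  exact: wo_lt_trans kb (wo_lt_trans bz (proj1 zj)).
- move=> _ [i Ji <-]; have [j ij] := Wlim i.
  by exists (N j); [exists j => //; exact: Jsucc ij|exact: Nuniv].
Qed.

(** If [U] had size at most kappa, a single piece would cover it, yet each piece has a proper
    extension among the pieces. *)
Lemma rich_card (J : set W) (N : W -> structure L V) U : J !=set0 ->
  (forall i, Kkappa (N i)) -> is_union N U -> rich U (N @` J) -> has_card U W.
Proof.
move=> [i0 Ji0] KN [UE _] [GK Gc Gu].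
have kW : [set: kappa] #<= [set: W] by case: Wsucc => _ [].
apply: Cantor_Bernstein.
  rewrite UE; apply: bigcup_card_le => //; first exact: card_le_trans kinf kW.
  by move=> i _; apply: card_le_trans kW; exact: Kkappa_le_card.
apply: (succ_card_le Wsucc) => Uk.
have GN : (N @` J) (N i0) by exists i0.
have [X [GX _ UX]] := Gc _ _ GN (@subset_refl _ _) Uk.
have [X' GX' XX'] := Gu X GX; have [KX _] := GK _ GX.
apply: (univ_proper KX XX') => x X'x; apply: UX.
by have [_ X'U] := GK _ GX'; exact: emb_dom X'U X'x.
Qed.

(** Two continuous filtrations of the same set by small sets interleave; at the supremum of omega
    interleaving steps they coincide. *)
Lemma agreement_club (X Y : W -> set V) :
  (forall i, X i #<= [set: kappa]) -> (forall i, Y i #<= [set: kappa]) ->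
  (forall i j, wo_lt i j -> X i `<=` X j) ->
  (forall i j, wo_lt i j -> Y i `<=` Y j) ->
  (forall i, is_limit i -> X i `<=` \bigcup_(j in [set j | wo_lt j i]) X j) ->
  (forall i, is_limit i -> Y i `<=` \bigcup_(j in [set j | wo_lt j i]) Y j) ->
  \bigcup_i X i = \bigcup_i Y i -> club [set i | X i = Y i].
Proof.
move=> Xk Yk Xinc Yinc Xc Yc XY.
have sub (Z : W -> set V) i j : (forall i j, wo_lt i j -> Z i `<=` Z j) ->
  wo_le i j -> Z i `<=` Z j by move=> Zinc /wo_le_eqVlt[->//|/Zinc].
split; last first.
  move=> a /is_limitE la acof.
  have acof' j : wo_lt j a -> exists c, [/\ X c = Y c, wo_le j c & wo_lt c a].
    move=> ja; have [c Cc jc] := acof (to_seg ja).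
    by exists (val c); split=> //; exact: seg_val_lt.
  apply/seteqP; split=> x.
    move=> /(Xc _ la)[j /acof'[c [E jc ca]] Xx].
    by apply: (Yinc _ _ ca); rewrite -E; exact: sub jc _ Xx.
  move=> /(Yc _ la)[j /acof'[c [E jc ca]] Yx].
  by apply: (Xinc _ _ ca); rewrite E; exact: sub jc _ Yx.
move=> i0.
(* By regularity of kappa^+, each stage of one filtration is swallowed by a stage of the other; [s]
   does this in both directions at once. *)
have /choice[s sP] : forall i, exists j, [/\ wo_lt i j,
  X i `<=` Y j & Y i `<=` X j].
  move=> i.
  have [|b bP] := @bounded_in_union Y (X i) _ (Xk i).
    by rewrite -XY => x Xx; exists i.
  have [|c cP] := @bounded_in_union X (Y i) _ (Yk i).
    by rewrite XY => x Yx; exists i.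
  have [z bz cz] := ordinal_bounded2 W_limit b c.
  have [j ij zj] := ordinal_bounded2 W_limit i z; exists j; split=> //.
    move=> x /bP[k kb]; apply: Yinc.
    exact: wo_lt_trans kb (wo_lt_trans bz zj).
  move=> x /cP[k kc]; apply: Xinc.
  exact: wo_lt_trans kc (wo_lt_trans cz zj).
pose c n := iter n s i0.
have cS n : [/\ wo_lt (c n) (c n.+1), X (c n) `<=` Y (c n.+1)
    & Y (c n) `<=` X (c n.+1)] by exact: sP.
have [|b bP] := succ_card_bounded kinf Wsucc (X := range c).
  exact: card_le_trans (card_image_le _ _) kinf.
have [a [aup _ acof]] := exists_lub bP.
have ca n : wo_lt (c n) a by apply: aup; exists n.
have la : is_limit a.
  apply: (@lub_limit _ (range c)) => //; first by exists i0, 0.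
  by move=> _ [n _ <-]; have [lt _ _] := cS n; exists (c n.+1) => //;
    exists n.+1.
exists a; last exact: wo_ltW (ca 0).
apply/seteqP; split=> x.
  move=> /(Xc _ la)[j /acof[_ [n _ <-] jn] Xx]; have [_ XY' _] := cS n.
  by apply: (Yinc _ _ (ca n.+1)); apply: XY'; exact: sub jn _ Xx.
move=> /(Yc _ la)[j /acof[_ [n _ <-] jn] Yx]; have [_ _ YX'] := cS n.
by apply: (Xinc _ _ (ca n.+1)); apply: YX'; exact: sub jn _ Yx.
Qed.

Hypothesis Sstat : stationary S.

Lemma main_union_not_chain_union (M N : W -> structure L V) U :
  (forall i, main_step i M (M i)) -> is_union M U ->
  (forall i, Kkappa (N i)) -> (forall i j, wo_lt i j -> le (N i) (N j)) ->
  (forall i, is_limit i -> dom (N i) `<=` \bigcup_(j in [set j | wo_lt j i]) dom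
    (N j)) ->
  ~ is_union N U.
Proof.
move=> HM [ME MU] KN Nle Nc [NE NU].
have KM i : Kkappa (M i) by case: (HM i).
have Minc i j : wo_lt i j -> emb (M i) (M j) id.
  by move=> ij; have [_ _ /(_ i ij)[h _] _ _] := HM j.
have Mle i j : wo_lt i j -> ~ S i -> le (M i) (M j).
  by move=> ij; have [_ _ /(_ i ij)[_ h] _ _] := HM j.
have C : club [set i | dom (M i) = dom (N i)].
  apply: agreement_club => //.
  - by move=> i; exact: Kkappa_le_card.
  - by move=> i; exact: Kkappa_le_card.
  - by move=> i j ij x Mx; exact: emb_dom (Minc _ _ ij) Mx.
  - by move=> i j /Nle/le_dom_sub.
  - by move=> i; case: (HM i).
  - by rewrite -ME NE.
have MN i : dom (M i) = dom (N i) -> M i = N i.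
  by apply: emb_same_dom; [exact: MU|exact: NU].
have [i [Si /MN Ei]] := Sstat C.
have [k ik] := limit_ordinal_is_limit W_limit i.
(* [M i], being [N i], is strong in [N j], which is [M j]; and the successor [k] is not in [S], so
   [M k] is strong in [M j] too. The size kappa of [M j] is the one that [coherent_le]
   prescribes. *)
have [j /MN Ej kj] := proj1 C k.
have ij : wo_lt i j by exact: wo_lt_le_trans (proj1 ik) kj.
have nSk : ~ S k by move=> /S_limit; exact: succ_not_limit ik.
have [_ _ _ _ /(_ i ik)[_ /(_ Si)]] := HM k; apply.
have lekj : le (M k) (M j).
  by have [->|/Mle] := wo_le_eqVlt kj;
    [exact: (Defs.le_refl HA (proj1 (KM j)))|exact].
have [f fS ff] := strong_strong_embedding (strong_le lekj).
split; [by case: (KM i)|by case: (KM k)|exact: Minc (proj1 ik)|].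
exists (M j), f; split=> //.
- by case: (KM j).
- rewrite /has_card (card_eql (proj2 (KM j))); apply: card_esym.
  exact: sum_card_kappa.
- by rewrite Ei Ej; exact: Nle.
Qed.

(** The model of size kappa^+ is built here as the union of a chain of universal extensions over
    [Ac l0], which makes it rich with a piece in common with the bad union; categoricity identifies
    it with any other. *)
Lemma free_not_isomorphic_exists : exists M U,
  [/\ categorical_model K W U, Linf_equiv W (str M) (str U), has_card M W
    & forall F, categorical_model K W F -> ~ isomorphic M F].
Proof.
have [M HM] := main_chain_exists.
have [N UN] := uchain_exists (@seg_card_le _ _ Wsucc) (AcK l0).
have [[w0] _] := W_limit; have [z zz] := exists_zero w0.
have KM i : Kkappa (M i) by case: (HM i).
have Minc i j : wo_lt i j -> emb (M i) (M j) id.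
  by move=> ij; have [_ _ /(_ i ij)[h _] _ _] := HM j.
have nSz : ~ S z by move=> /S_limit/limit_not_zero.
have [||MU /is_union_setT MMU] := @union_on_exists _ _ W setT M.
- by exists z.
- by move=> i j _ _; exact: Minc.
have [||NU /is_union_setT NNU] := @union_on_exists _ _ W setT N.
- by exists z.
- by apply: le_increasing_on => i j _ _; exact: (uc_le UN).
have Mrich : rich MU (M @` (~` S)).
  apply: rich_of_chain MMU => //.
  - by move=> i j ij nSi; have [_ _ /(_ i ij)[_ h] _ _] := HM j; exact: h.
  - by move=> i j /succ_not_limit nj /S_limit.
  - move=> i j nSi ij; apply: limit_model_univ.
    by have [_ _ _ _ /(_ i ij)[h _]] := HM j; apply: h => //; exact: wo_refl.
have Nrich : rich NU (N @` setT).
  apply: rich_of_chain NNU => //.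
  - exact: uc_Kkappa UN.
  - by move=> i j ij; exact: le_emb (uc_le UN ij).
  - by move=> i j ij _; exact: (uc_le UN).
  - by move=> i j _; exact: (uc_univ UN).
have [KNU leNU] := uchain_union W_limit UN NNU.
have cNU : has_card NU W.
  by apply: rich_card NNU Nrich; [exists z|exact: uc_Kkappa UN].
have catNU : categorical_model K W NU.
  split=> // A KA cA; have [F0 [_ _ F0u]] := sc_categorical SC.
  have /isoP[f fI] := F0u A KA cA; have /isoP[g gI] := F0u NU KNU cNU.
  have [h [hI _ _]] := iso_inv gI; apply/isoP; exists (h \o f);
    exact: iso_comp fI hI.
exists MU, NU; split=> //.
- apply: (rich_equiv Mrich Nrich); exists (Ac l0).
    by exists z => //; case: (HM z) => _ -> //.
  by exists z => //; exact: uc_zero UN _ zz.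
- by apply: rich_card MMU Mrich => //; exists z.
move=> F [KF cF _] /isoP[f fI].
have [f' [f'I _ _]] := iso_inv fI.
have [_ _ NUu] := catNU; have /isoP[g gI] := NUu F KF cF.
have [g' [g'I _ _]] := iso_inv gI; have hI := iso_comp g'I f'I.
set h := f' \o g' in hI.
(* An isomorphism would carry this strong chain to one with union [MU] itself, as
   [main_union_not_chain_union] forbids. *)
have /choice[N' N'I] : forall i, exists X, iso (N i) X h.
  move=> i; apply: copy_exists => x y Nx Ny.
  by apply: (emb_inj (iso_emb hI)); exact: le_dom_sub (leNU i) _ _.
apply: (main_union_not_chain_union (N := N') HM MMU).
- by move=> i; exact: Kkappa_iso (N'I i) (uc_Kkappa UN i).
- by move=> i j ij; exact: le_iso_map (N'I i) (N'I j) _ (uc_le UN ij).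
- move=> i li y; rewrite (iso_image (N'I i)) => -[x /(uc_cont UN li)[j ji Nx]
    <-].
  by exists j => //; exact: emb_dom (iso_emb (N'I j)) Nx.
have NUd i : dom (N i) `<=` dom NU by exact: le_dom_sub.
split.
  rewrite (iso_image hI); case: NNU => -> _; apply/seteqP; split=> y.
    by move=> [x [i _ Nx] <-]; exists i => //;
      exact: emb_dom (iso_emb (N'I i)) Nx.
  by move=> [i _]; rewrite (iso_image (N'I i)) => -[x Nx <-]; exists x => //;
    exists i.
move=> i; have [k [kI hk kh]] := iso_inv (N'I i).
suff : emb (N' i) MU id by [].
apply: (@emb_ext _ _ _ _ (h \o k)) => [y N'y|]; first exact: kh.
apply: (@emb_comp _ _ _ NU _ k h _ (iso_emb hI)).
exact: (@emb_comp _ _ _ _ _ k id (iso_emb kI) (le_emb (leNU i))).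
Qed.

End Class.

Theorem theorem3p17 (L : language) (V : Type)
  (K : structure L V -> Prop) (le : structure L V -> structure L V -> Prop)
  (mu kappa : Type) (kappa_succ : wellorder) (lam delta : wellorder)
  (F : structure L V) :
  weak_AEC K le mu ->
  [set: mu + nat] #<= [set: kappa] ->
  is_succ_cardinal kappa kappa_succ ->
  E_plus kappa_succ ->
  strongly_categorical K le kappa kappa_succ ->
  is_regular_cardinal lam -> [set: lam] #<= [set: kappa] ->
  is_limit_ordinal delta -> ord_lt delta kappa_succ ->
  CP K le mu kappa delta lam ->
  categorical_model K kappa_succ F ->
  (exists M : structure L V,
     [/\ Linf_free K kappa_succ M, has_card M kappa_succ & ~ isomorphic M F]) /\
  ~ axiomatisable kappa_succ K.
Proof.
move=> HK mukappa Wsucc Eplus SC lamreg lamk dlim dW.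
move=> [A [B [[[KA Ale Alim] cA] [KB cB] Asucc Blim [U AU UB]]]] catF.
have kW : card_lt kappa kappa_succ by case: Wsucc.
have lamW : card_lt lam kappa_succ.
  split=> [|Wlam]; first exact: card_le_trans lamk (proj1 kW).
  exact: (proj2 kW) (card_le_trans Wlam lamk).
have limE := limit_overE HK mukappa Wsucc SC delta.
have [S [Sstat Scof Snr]] := Eplus lam lamreg lamW.
have [[l] _] := lam_limit lamreg; have [l0 l0z] := exists_zero l.
have [|||||M [N [catN MN cM MF]]] :=
  free_not_isomorphic_exists HK mukappa Wsucc SC
  dlim dW lamreg Scof Snr (Ac := A) (Bc := B) (Uc :=
    U) _ _ _ _ _ AU UB l0z Sstat.
- by [].
- by [].
- by move=> i /is_limitE/Alim/is_union_seg.
- by move=> i j /Asucc/limE.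
- by move=> i; apply/limE.
- split; first by exists M; split=> //; [exists N|exact: MF].
  (* An axiomatised class is closed under the equivalence, so [M] would be in K; having size
     kappa^+, it would be isomorphic to [F] by categoricity. *)
  move=> [Phi PhiE]; apply: (MF _ catF).
  case: catF => _ _; apply=> //; apply/PhiE => phi /(proj1 (PhiE N)).
  case: catN => KN _ _ /(_ KN) Nphi; exact/MN.
Qed.
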